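(* Let $n,k,r$ be integers with $n \ge n'_{k,r} \ge k \ge 4r \ge 12$. If $\mathcal H$ is an $n$-vertex connected $r$-uniform hypergraph with no Berge path of length $k$, then $$|E(\mathcal H)| \le f(n,k,r,\lfloor (k-1)/2\rfloor) = f^*(n,k,r,\lfloor (k-1)/2\rfloor).$$
   Context: Hypergraphs have no multiple edges. A Berge path of length $\ell$ in a hypergraph is a set of $\ell+1$ distinct vertices $\{v_1,\dots,v_{\ell+1}\}$ and $\ell$ distinct edges $\{e_1,\dots,e_\ell\}$ such that $\{v_i,v_{i+1}\}\subseteq e_i$ for all $1\le i\le \ell$. A hypergraph is connected if its incidence bigraph (the bipartite graph with parts $E(\mathcal H)$ and $V(\mathcal H)$, an edge $a$ being adjacent to a vertex $y$ iff $y\in a$) is connected. Define $$f(n,k,r,a) := \binom{k-a}{\min\{r,\lfloor\frac{k-a}{2}\rfloor\}} + (n-k+a)\binom{a}{\min\{r-1,\lfloor a/2\rfloor\}},$$ $$f^*(n,k,r,a) := \binom{k-a}{r} + (n-k+a)\binom{a}{r-1}.$$ For integers $k\ge r$, $n'_{k,r}$ is the smallest positive integer $n$ such that $f(n,k,r,\lfloor (k-1)/2\rfloor)\ge f(n,k,r,1)$. *)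

(* Defs.v *)
From mathcomp Require Import all_boot all_order all_algebra.

Set Implicit Arguments.
Unset Strict Implicit.
Unset Printing Implicit Defensive.

Import Order.TTheory GRing.Theory Num.Theory.

(* A hypergraph on a finite vertex type T is its set of edges E : {set {set T}}. *)
Section Hypergraph.
Variables (T : finType) (E : {set {set T}}).

Definition uniform (r : nat) : Prop := forall e, e \in E -> #|e| = r.

(* Adjacency on the disjoint union of V(H) = T and E(H): vertices outside every
   edge are still present as isolated vertices of the bigraph. *)
Definition incidence_bigraph : rel (T + {e : {set T} | e \in E}) :=
  fun x y =>
    match x, y with
    | inl v, inr e => v \in val e
    | inr e, inl v => v \in val e
    | _, _ => false
    end.

Definition connected_hypergraph : Prop :=
  forall x y, connect incidence_bigraph x y.

(* Indices are shifted to start at 0: widen_ord and lift ord0 send i : 'I_l to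
   i and i.+1 in 'I_l.+1. *)
Definition berge_path (l : nat) (v : 'I_l.+1 -> T) (e : 'I_l -> {set T}) : Prop :=
  [/\ injective v, injective e, (forall i, e i \in E)
    & forall i, [set v (widen_ord (leqnSn l) i); v (lift ord0 i)] \subset e i].

Definition has_berge_path (l : nat) : Prop := exists v e, @berge_path l v e.

End Hypergraph.

(* Integer-valued because n - k + a is negative for small n, and such n compete
   in the minimum below; k - a is only used with a <= k. *)
Definition f (n k r a : nat) : int :=
  ('C(k - a, minn r (k - a)./2)%:Z
   + (n%:Z - k%:Z + a%:Z) * 'C(a, minn (r - 1) a./2)%:Z)%R.

Definition fstar (n k r a : nat) : int :=
  ('C(k - a, r)%:Z + (n%:Z - k%:Z + a%:Z) * 'C(a, r - 1)%:Z)%R.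

Definition is_nprime (k r m : nat) : Prop :=
  let P n := [/\ 0 < n & (f n k r 1 <= f n k r (k - 1)./2)%R] in
  P m /\ forall n, P n -> m <= n.

(* Main.v *)
Require Import Defs.
From mathcomp Require Import all_boot all_order all_algebra.
From mathcomp Require Import zify.

(** Why the bound holds.

    Consider the incidences between pairs of vertices and the hyperedges that
    contain them.  Taking a set X of hyperedges of maximum deficiency, Hall's
    theorem [hall] yields a graph G on the vertex set whose edges are matched
    injectively into hyperedges containing them, in such a way that every
    hyperedge outside X is matched to a pair of its own (a blue edge of G) and
    every hyperedge of X is a clique of G without blue edges
    ([matching_decomposition]).  So the number of hyperedges is the number of
    r-sets in X plus the number of blue edges, all of them cliques of G and none
    inside another, while a path of G with k edges would lift, through the
    matching, to a Berge path of length k.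

    This count is controlled by degrees in G: deleting a vertex of degree at
    most d loses at most max(C(d, r-1), d) of these cliques, and m >= r+2
    remaining vertices carry at most C(m, r) of them ([weight_bound]).  With
    t = floor((k-1)/2), if every set of more than k-t vertices has a vertex of
    degree at most t inside it, deleting such vertices down to k-t of them gives
    exactly the claimed bound.

    Otherwise G has a nonempty subset of minimum degree above t, and the method
    of Kopylov applies ([kopylov_core]): there is a set K, with
    t+2 <= |K| <= k, that spans a cycle of G and is maximal among the sets that
    can be treated as cliques for the purpose of finding cycles and paths
    ([free_clique]).  Put a = k - |K|.  If all vertices outside K can be deleted
    in turn with degree at most a, the count gives
    C(k-a, r) + (n-k+a) max(C(a, r-1), a), a convex function of a, which is at
    most the larger of its values at a = 1 and a = t; the hypothesis on n makes
    the value at t the larger one ([core_bound_le]).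

    If they cannot, the maximality of K produces a set U disjoint from K, not
    adjacent to K in G, in which all degrees exceed a.  This is where
    connectivity of the hypergraph enters: a shortest Berge walk from K to U,
    preceded by the |K|-1 edges of a spanning path of K and followed by a
    path with a edges in U, is a Berge path of length at least k
    ([berge_path_from_cycle]).  The same argument with a = 0, U being the
    complement of K, excludes |K| = k, because n > k ([threshold_gt]). *)

Set Implicit Arguments.
Unset Strict Implicit.
Unset Printing Implicit Defensive.

(** * Rerouting cycles and paths along crossing edges *)

Section Rotations.
Variable T : eqType.
Implicit Types (e : rel T) (x y z : T) (s c p q : seq T).

(** P is counted on all entries but the first and Q on all but the last, so both
    counts range over the [size s] pairs of consecutive entries; the two
    families of pairs overlap once they have more than [size s] members. *)
Lemma adjacent_pigeonhole (P Q : pred T) x s :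
    size s < count P s + count Q (belast x s) ->
  exists p y z q, [/\ x :: s = p ++ y :: z :: q, Q y & P z].
Proof.
elim: s x => [|z s IH] x //=.
case Qx: (Q x); case Pz: (P z) => //= lt.
- by exists [::], x, z, s.
- by have [|p [y [w [q [-> Qy Pw]]]]] := IH z; [lia | exists (x :: p), y, w, q].
- by have [|p [y [w [q [-> Qy Pw]]]]] := IH z; [lia | exists (x :: p), y, w, q].
- by have [|p [y [w [q [-> Qy Pw]]]]] := IH z; [lia | exists (x :: p), y, w, q].
Qed.

Fixpoint nonsteps e x s : nat :=
  if s is y :: s' then ~~ e x y + nonsteps e y s' else 0.

Definition cycle_nonsteps e c := if c is x :: s then nonsteps e x (rcons s x) else 0.

Lemma nonsteps_cat e x s1 s2 :
  nonsteps e x (s1 ++ s2) = nonsteps e x s1 + nonsteps e (last x s1) s2.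
Proof. by elim: s1 x => //= y s1 IH x; rewrite IH addnA. Qed.

Lemma nonsteps_rcons e x s y : nonsteps e x (rcons s y) = nonsteps e x s + ~~ e (last x s) y.
Proof. by rewrite -cats1 nonsteps_cat /= addn0. Qed.

Lemma last_rev_belast x s : last (last x s) (rev (belast x s)) = x.
Proof. by case: s => //= y s; rewrite rev_cons last_rcons. Qed.

Lemma nonsteps_rev e x s : symmetric e ->
  nonsteps e (last x s) (rev (belast x s)) = nonsteps e x s.
Proof.
move=> sym; elim: s x => //= y s IH x.
by rewrite rev_cons nonsteps_rcons IH last_rev_belast sym addnC.
Qed.

Lemma cycle_nonsteps_rot1 e c : cycle_nonsteps e (rot 1 c) = cycle_nonsteps e c.
Proof.
case: c => [|x [|y s]] //; rewrite rot1_cons /= !nonsteps_rcons last_rcons /=; lia.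
Qed.

Lemma cycle_nonsteps_rot e n c : cycle_nonsteps e (rot n c) = cycle_nonsteps e c.
Proof.
have [le|lt] := leqP n (size c); last by rewrite rot_oversize // ltnW.
elim: n le => [|n IH] le; first by rewrite rot0.
by rewrite rotS // cycle_nonsteps_rot1 IH // ltnW.
Qed.

(** Rotation is what allows a missing edge to be assumed to be the closing one,
    so that removing it leaves a path. *)
Lemma cycle_gap e c : ~~ cycle e c ->
  exists n x s, rot n c = x :: s /\ ~~ e (last x s) x.
Proof.
case: c => // x s; rewrite /cycle rcons_path negb_and => /orP[|ne]; last first.
  by exists 0, x, s; rewrite rot0.
have gap y s' : ~~ path e y s' ->
    exists p z q, s' = p ++ z :: q /\ ~~ e (last y p) z.
  elim: s' y => //= z s' IH y; rewrite negb_and => /orP[nyz|/IH].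
    by exists [::], z, s'.
  by move=> [p [w [q [-> nw]]]]; exists (z :: p), w, q.
move=> /gap[p [z [q [-> nz]]]]; exists (size p).+1, z, (q ++ x :: p).
by rewrite -cat_cons -[(size p).+1]/(size (x :: p)) rot_size_cat last_cat.
Qed.

Lemma rev_path_sym e x s : symmetric e ->
  path e (last x s) (rev (belast x s)) = path e x s.
Proof. by move=> sym; rewrite rev_path; apply: eq_path => u v; rewrite sym. Qed.

Lemma crossing e x s : symmetric e -> irreflexive e ->
    (size s).+1 <= count (e x) (x :: s) + count (e (last x s)) (x :: s) ->
  exists p y z q, [/\ x :: s = p ++ y :: z :: q, e (last x s) y & e x z].
Proof.
move=> sym irr le; apply: adjacent_pigeonhole.
move: le; rewrite {2}lastI /= irr -cats1 count_cat /= irr; lia.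
Qed.

(** Along v_1 ... v_N, edges v_1 v_(i+1) and v_N v_i close the path into the
    cycle v_1 ... v_i v_N ... v_(i+1).  The two new edges are in the good relation
    [e], and at most the step v_i v_(i+1) is lost, so the
    cycle has no more steps outside [e] than the path. *)
Lemma crossing_swap e e' x s p y z q :
    symmetric e' -> x :: s = p ++ y :: z :: q -> path e' x s ->
    subrel e e' -> symmetric e -> e (last x s) y -> e x z ->
  let c := p ++ y :: rev (z :: q) in
  [/\ perm_eq (x :: s) c, cycle e' c & cycle_nonsteps e c <= nonsteps e x s].
Proof.
move=> sym' E pth sub sym ey ez c.
have pc : perm_eq (x :: s) c.
  by rewrite E perm_cat2l perm_cons perm_sym perm_rev.
have El : last x s = last z q.
  by rewrite -[last x s](last_cons x) E last_cat.
move: pth ey pc; rewrite El /c; case: p E {c El} => [|a p] /= [? Es].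
  subst x s => /= /andP[_ pth] ey pc.
  rewrite /cycle /cycle_nonsteps; split => //.
    rewrite lastI rev_rcons /= sub 1?sym // rcons_path rev_path_sym // pth.
    by rewrite last_rev_belast sym' sub.
  rewrite lastI rev_rcons /= nonsteps_rcons nonsteps_rev // last_rev_belast.
  by rewrite sym ey sym ez /=; lia.
subst x s; rewrite cat_path /= => /andP[pp /and3P[e1 e2 pth]] ey pc.
rewrite (lastI z q) rev_rcons; split; first by rewrite -rev_rcons -lastI.
  rewrite /cycle rcons_path cat_path /= pp e1 rev_path_sym // pth !last_cat /=.
  rewrite last_rev_belast sub 1?sym //=.
  by rewrite sym' sub.
rewrite /cycle_nonsteps nonsteps_rcons !nonsteps_cat /= nonsteps_rev // last_cat /= last_rev_belast.
by rewrite -lastI (sym y) ey (sym z) ez /=; lia.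
Qed.

(** The Bondy-Chvatal closure: a cycle using auxiliary edges whose ends have
    degree sum at least the length of the cycle can be rerouted through genuine
    edges on the same vertices.  Each crossing removes one auxiliary edge, which
    is first rotated to the closing position. *)
Lemma bondy_chvatal e e' c : symmetric e -> irreflexive e -> symmetric e' ->
    subrel e e' ->
    (forall x y, e' x y -> ~~ e x y -> size c <= count (e x) c + count (e y) c) ->
    cycle e' c ->
  exists2 c', perm_eq c c' & cycle e c'.
Proof.
move=> sym irr sym' sub; have [b] := ubnP (cycle_nonsteps e c).
elim: b c => // b IH c lb deg cyc.
have [c0|cn0] := boolP (cycle e c); first by exists c.
have [n [x [s [Ec ne]]]] := cycle_gap cn0.
have pc : perm_eq c (x :: s) by rewrite -Ec perm_sym perm_rot.
have cyc2 : cycle e' (x :: s) by rewrite -Ec rot_cycle.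
have bc : cycle_nonsteps e (x :: s) = cycle_nonsteps e c by rewrite -Ec cycle_nonsteps_rot.
have sz : size c = (size s).+1 by rewrite (perm_size pc).
have pth : path e' x s by move: cyc2; rewrite /cycle rcons_path => /andP[].
have [| p [y [z [q [E ey ez]]]]] := @crossing e x s sym irr.
  rewrite -sz addnC -!(permP pc); apply: deg => //.
  by move: cyc2; rewrite /cycle rcons_path => /andP[].
have [pc' cc bb] := crossing_swap sym' E pth sub sym ey ez.
have pcc : perm_eq c (p ++ y :: rev (z :: q)) := perm_trans pc pc'.
have [||//|c' pc'' ?] := IH (p ++ y :: rev (z :: q)).
- have : cycle_nonsteps e c = nonsteps e x s + 1 by rewrite -bc /cycle_nonsteps nonsteps_rcons ne.
  lia.
- by move=> u v ? ?; rewrite -(perm_size pcc) -!(permP pcc); apply: deg.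
by exists c' => //; apply: perm_trans pcc pc''.
Qed.

End Rotations.

Section PathClosure.
Variable T : eqType.
Implicit Types (e : rel T) (s : seq T).

(** Adding a vertex adjacent to all others turns spanning paths into spanning
    cycles, and raises each degree by one and the number of vertices by one. *)
Definition cone e : rel (option T) := fun u v =>
  match u, v with
  | Some x, Some y => e x y
  | None, None => false
  | _, _ => true
  end.

Lemma cone_cycle e s : s != [::] -> cycle (cone e) (None :: map Some s) = sorted e s.
Proof.
case: s => // x s _; rewrite /cycle /= rcons_path last_map /= andbT.
by elim: s x => //= y s IH x; rewrite IH.
Qed.

Lemma count_cone e x s :
  count (cone e (Some x)) (None :: map Some s) = (count (e x) s).+1.
Proof. by rewrite /= count_map. Qed.

(** The threshold drops by one with respect to cycles, by passing to the cone. *)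
Lemma bondy_chvatal_path e e' s : uniq s -> symmetric e -> irreflexive e ->
    symmetric e' -> subrel e e' ->
    (forall x y, e' x y -> ~~ e x y -> size s <= (count (e x) s + count (e y) s).+1) ->
    sorted e' s ->
  exists2 s', perm_eq s s' & sorted e s'.
Proof.
move=> Us sym irr sym' sub deg; have [-> _|sn0] := eqVneq s [::]; first by exists [::].
rewrite -(cone_cycle _ sn0) => cyc.
have csym f : symmetric f -> symmetric (cone f) by move=> symf [x|] [y|] //=.
have cirr : irreflexive (cone e) by case=> [x|] //=.
have csub : subrel (cone e) (cone e') by move=> [x|] [y|] //=; apply: sub.
have cdeg u v : cone e' u v -> ~~ cone e u v ->
    size (None :: map Some s) <=
      count (cone e u) (None :: map Some s) + count (cone e v) (None :: map Some s).
  case: u v => [x|] [y|] // e'xy nexy.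
  by rewrite !count_cone /= size_map; have := deg x y e'xy nexy; lia.
have [c pc cc] := bondy_chvatal (csym _ sym) cirr (csym _ sym') csub cdeg cyc.
have cN : None \in c by rewrite -(perm_mem pc) mem_head.
have [n c' Ec] := rot_to cN.
have pc' : perm_eq (map Some s) c'.
  by rewrite -(perm_cons None) -Ec (perm_trans pc) // perm_sym perm_rot.
have Ec' : c' = map Some (pmap id c').
  have : None \notin c' by rewrite -(perm_mem pc'); apply/mapP => -[].
  elim: c' {Ec pc'} => //= -[x|] c' IH; rewrite inE //= => nc.
  by rewrite -IH.
have ps : perm_eq s (pmap id c').
  rewrite Ec' in pc'; apply: perm_map_inj pc'; exact: Some_inj.
exists (pmap id c') => //; rewrite -cone_cycle; first by rewrite -Ec' -Ec rot_cycle.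
by rewrite -size_eq0 -(perm_size ps) size_eq0.
Qed.

End PathClosure.

(** * Sets that behave like cliques *)

Section Cores.
Variable T : finType.
Implicit Types (e : rel T) (s c : seq T) (A B C K : {set T}) (x y z : T).

Definition deg e A v := #|[set z in A | e v z]|.

Lemma closed_deg_le_count e A v s : uniq s ->
  (forall z, z \in A -> e v z -> z \in s) -> deg e A v <= count (e v) s.
Proof.
move=> Us sub; rewrite -size_filter -(card_uniqP (filter_uniq (e v) Us)).
apply/subset_leq_card/subsetP => z; rewrite inE mem_filter => /andP[zA evz].
by rewrite evz sub.
Qed.

Lemma deg_le_count e A v s : uniq s -> {subset A <= s} -> deg e A v <= count (e v) s.
Proof. by move=> Us sub; apply: closed_deg_le_count => // z /sub. Qed.

(** Ore's theorem for a given path: only the degrees of its two ends matter. *)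
Lemma ore_cycle e x s : symmetric e -> irreflexive e -> path e x s ->
    size s < count (e x) (x :: s) + count (e (last x s)) (x :: s) ->
  exists2 c, perm_eq (x :: s) c & cycle e c.
Proof.
move=> sym irr pth /(crossing sym irr)[p [y [z [q [E ey ez]]]]].
have [pc cc _] := crossing_swap sym E pth (fun _ _ => id) sym ey ez.
by exists (p ++ y :: rev (z :: q)).
Qed.

Definition add_clique e K : rel T :=
  fun x y => e x y || [&& x \in K, y \in K & x != y].

Lemma add_clique_sym e K : symmetric e -> symmetric (add_clique e K).
Proof. by move=> sym x y; rewrite /add_clique sym eq_sym andbCA. Qed.

Lemma add_clique_irr e K : irreflexive e -> irreflexive (add_clique e K).
Proof. by move=> irr x; rewrite /add_clique irr eqxx !andbF. Qed.

Lemma deg_add_clique e K A x : x \in K -> K \subset A ->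
  #|K|.-1 <= deg (add_clique e K) A x.
Proof.
move=> xK KA; rewrite (cardsD1 x K) xK.
apply/subset_leq_card/subsetP => z; rewrite !inE /add_clique => /andP[zx zK].
by rewrite (subsetP KA) // xK zK eq_sym zx orbT.
Qed.

Variables (e : rel T) (k : nat).
Hypotheses (sym : symmetric e) (irr : irreflexive e).

(** K may be turned into a clique without creating cycles on a set of at most k
    vertices, or paths on a set of at most k+1 vertices, that contains K and did
    not already carry one.  Kopylov's proof adds edges to the graph until no more
    can be added; this relative notion gives the same freedom while the graph
    itself, and hence its matching into hyperedges, stays fixed. *)
Definition free_clique K :=
  (forall c, uniq c -> {subset K <= c} -> size c <= k -> cycle (add_clique e K) c ->
     exists2 c', perm_eq c c' & cycle e c')
  /\ (forall s, uniq s -> {subset K <= s} -> size s <= k.+1 ->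
     sorted (add_clique e K) s -> exists2 s', perm_eq s s' & sorted e s').

Lemma core_free_clique K : (forall x, x \in K -> k <= (deg e K x).*2) -> free_clique K.
Proof.
move=> dK.
have sub : subrel e (add_clique e K) by move=> x y exy; rewrite /add_clique exy.
have dxy s x y : uniq s -> {subset K <= s} -> add_clique e K x y -> ~~ e x y ->
    k <= count (e x) s + count (e y) s.
  move=> Us Ks /orP[->//|/and3P[xK yK _] _].
  have := dK x xK; have := dK y yK.
  have := deg_le_count e x Us Ks; have := deg_le_count e y Us Ks; lia.
split=> c Uc Kc sz.
  apply: bondy_chvatal => //; first exact: add_clique_sym.
  by move=> x y e1 e2; apply: leq_trans sz _; apply: dxy.
apply: bondy_chvatal_path => //; first exact: add_clique_sym.
by move=> x y e1 e2; apply: leq_trans sz _; rewrite ltnS; apply: dxy.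
Qed.

(** Once K is a clique, a vertex u of C outside K and a vertex of K have degree
    sum at least (|K| - 1) + (k + 1 - |K|) = k, so u may be joined to all of K;
    after that two vertices of C outside K have degree at least |K| each, and may be
    joined too.  Rerouting undoes the two steps in the reverse order. *)
Lemma absorb_free_clique K C : free_clique K -> K \subset C -> k <= (#|K|).*2 ->
    (forall u, u \in C -> u \notin K -> k < #|K| + deg e C u) ->
  free_clique C.
Proof.
move=> [fc fp] KC kK dC.
pose e1 : rel T := add_clique e K.
pose e2 : rel T := fun x y => e1 x y ||
  [&& x \in C, y \in C, x != y & (x \in K) || (y \in K)].
have sym1 : symmetric e1 := add_clique_sym K sym.
have irr1 : irreflexive e1 := add_clique_irr K irr.
have sym2 : symmetric e2.
  by move=> x y; rewrite /e2 sym1 eq_sym andbCA orbC (orbC (x \in K)) orbC.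
have irr2 : irreflexive e2 by move=> x; rewrite /e2 irr1 eqxx !andbF.
have sub1 : subrel e1 e2 by move=> x y exy; rewrite /e2 exy.
have sub2 : subrel e2 (add_clique e C).
  move=> x y; rewrite /add_clique => /orP[/orP[->//|/and3P[xK yK nxy]]|/and4P[xC yC nxy _]].
    by rewrite (subsetP KC x xK) (subsetP KC y yK) nxy orbT.
  by rewrite xC yC nxy orbT.
(* second step: pairs outside K, whose ends are already joined to K *)
have d2 s x y : uniq s -> {subset C <= s} -> add_clique e C x y -> ~~ e2 x y ->
    k <= count (e2 x) s + count (e2 y) s.
  move=> Us Cs exy nexy.
  have [xC yC nK] : [/\ x \in C, y \in C & ~~ ((x \in K) || (y \in K))].
    move: exy nexy; rewrite /add_clique /e2 /e1 /add_clique.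
    by case: (e x y) => //= /and3P[-> -> ->] /=; rewrite negb_or => /andP[].
  have big u : u \in C -> u \notin K -> #|K| <= count (e2 u) s.
    move=> uC uK; apply: leq_trans (deg_le_count _ u Us (A := K) _); last first.
      by move=> z zK; rewrite Cs // (subsetP KC).
    apply/subset_leq_card/subsetP => z zK; rewrite inE zK /e2 uC (subsetP KC) //= zK.
    by rewrite orbT andbT (contraNneq _ uK) ?orbT // => ->.
  move: nK; rewrite negb_or => /andP[xK yK].
  have := big x xC xK; have := big y yC yK; lia.
(* first step: one end x in K, the other y outside *)
have d1 s x y : uniq s -> {subset C <= s} -> e2 x y -> ~~ e1 x y ->
    k <= count (e1 x) s + count (e1 y) s.
  move=> Us Cs.
  wlog xK : x y / x \in K.
    move=> W exy nexy; have /orP[xK|yK] : (x \in K) || (y \in K).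
    - by move: exy; rewrite /e2 (negbTE nexy) => /and4P[].
    - exact: W.
    - by rewrite addnC W // 1?sym2 // sym1.
  move=> exy nexy; have [yC yK] : y \in C /\ y \notin K.
    move: exy; rewrite /e2 (negbTE nexy) => /and4P[_ -> nxy _]; split=> //.
    by apply: contra nexy => yK; rewrite /e1 /add_clique xK yK nxy orbT.
  have := dC y yC yK.
  have := deg_le_count e1 x Us Cs; have := deg_le_count e1 y Us Cs.
  have := deg_add_clique e xK KC; rewrite -/e1.
  have : deg e C y <= deg e1 C y.
    apply/subset_leq_card/subsetP => z; rewrite !inE /e1 /add_clique.
    by case/andP=> -> ->.
  have : 0 < #|K| by apply/card_gt0P; exists x.
  lia.
split=> c Uc Cc sz cyc.
  have [|c1 pc1 cc1] := bondy_chvatal sym2 irr2 (add_clique_sym C sym) sub2 _ cyc.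
    by move=> x y ? ?; apply: leq_trans sz _; apply: d2.
  have Uc1 : uniq c1 by rewrite -(perm_uniq pc1).
  have Cc1 : {subset C <= c1} by move=> z /Cc; rewrite (perm_mem pc1).
  have sz1 : size c1 <= k by rewrite -(perm_size pc1).
  have [|c2 pc2 cc2] := bondy_chvatal sym1 irr1 sym2 sub1 _ cc1.
    by move=> x y ? ?; apply: leq_trans sz1 _; apply: d1.
  have [||||c3 pc3 cc3] := fc c2.
  - by rewrite -(perm_uniq pc2).
  - by move=> z /(subsetP KC)/Cc1; rewrite (perm_mem pc2).
  - by rewrite -(perm_size pc2).
  - by [].
  by exists c3 => //; apply: perm_trans pc1 (perm_trans pc2 pc3).
have [|c1 pc1 cc1] := bondy_chvatal_path Uc sym2 irr2 (add_clique_sym C sym) sub2 _ cyc.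
  by move=> x y ? ?; apply: leq_trans sz _; rewrite ltnS; apply: d2.
have Uc1 : uniq c1 by rewrite -(perm_uniq pc1).
have Cc1 : {subset C <= c1} by move=> z /Cc; rewrite (perm_mem pc1).
have sz1 : size c1 <= k.+1 by rewrite -(perm_size pc1).
have [|c2 pc2 cc2] := bondy_chvatal_path Uc1 sym1 irr1 sym2 sub1 _ cc1.
  by move=> x y ? ?; apply: leq_trans sz1 _; rewrite ltnS; apply: d1.
have [||||c3 pc3 cc3] := fp c2.
- by rewrite -(perm_uniq pc2).
- by move=> z /(subsetP KC)/Cc1; rewrite (perm_mem pc2).
- by rewrite -(perm_size pc2).
- by [].
by exists c3 => //; apply: perm_trans pc1 (perm_trans pc2 pc3).
Qed.

End Cores.

(** * Kopylov's core *)

Section Kopylov.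
Variable T : finType.
Implicit Types (e : rel T) (s c : seq T) (A B C K J : {set T}) (x y z : T).

(** Let a path through K inside J be as long as possible among those with at most
    k vertices.  Its ends have no neighbours in J off the path, so by assumption
    its vertices carry a cycle; an edge from the cycle to another vertex of J would
    open it into a longer path.  As paths grow one vertex at a time and k+1
    vertices are impossible, the bound k is never crossed. *)
Lemma longest_closed_cycle e k J K s0 : symmetric e -> s0 != [::] ->
    uniq s0 -> {subset K <= s0} -> {subset s0 <= J} -> size s0 <= k -> sorted e s0 ->
    (forall s, uniq s -> {subset K <= s} -> {subset s <= J} -> sorted e s ->
       size s != k.+1) ->
    (forall x s, uniq (x :: s) -> {subset K <= x :: s} -> {subset x :: s <= J} ->
       size s < k -> path e x s ->
       (forall z, z \in J -> e x z -> z \in x :: s) ->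
       (forall z, z \in J -> e (last x s) z -> z \in x :: s) ->
       exists2 c, perm_eq (x :: s) c & cycle e c) ->
  exists c, [/\ c != [::], uniq c, {subset K <= c}, {subset c <= J} & size c <= k] /\
    (cycle e c /\ forall x z, x \in c -> z \in J -> e x z -> z \in c).
Proof.
move=> sym s0n Us0 Ks0 s0J sz0 ss0 no_path close.
have [b] := ubnP (k - size s0); elim: b s0 s0n Us0 Ks0 s0J sz0 ss0 => // b IH s0 s0n.
have grow s : size s = (size s0).+1 -> uniq s -> {subset K <= s} -> {subset s <= J} ->
    size s0 <= k -> sorted e s -> k - size s0 < b.+1 ->
    exists c, [/\ c != [::], uniq c, {subset K <= c}, {subset c <= J} & size c <= k] /\
      (cycle e c /\ forall x z, x \in c -> z \in J -> e x z -> z \in c).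
  move=> Es Us Ks sJ szk ss lt.
  have := no_path s Us Ks sJ ss; rewrite Es eqSS => ne.
  apply: (IH s) => //; last by lia.
    by rewrite -size_eq0 Es.
  by rewrite Es ltn_neqAle ne.
case: s0 s0n {IH} grow => // x s _ grow Us Ks sJ sz pth lt.
have ext y r : perm_eq (x :: s) (y :: r) -> path e y r ->
    forall z, z \in J -> e y z -> z \notin x :: s -> exists c,
    [/\ c != [::], uniq c, {subset K <= c}, {subset c <= J} & size c <= k] /\
      (cycle e c /\ forall x z, x \in c -> z \in J -> e x z -> z \in c).
  move=> pr pyr z zJ eyz zn; have mr := perm_mem pr.
  apply: (grow (z :: y :: r)) => //.
  - by rewrite -[size (z :: _)]/(size (y :: r)).+1 -(perm_size pr).
  - by rewrite cons_uniq -mr zn -(perm_uniq pr).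
  - by move=> w /Ks ws; rewrite inE -mr ws orbT.
  - by move=> w; rewrite inE -mr => /predU1P[->//|/sJ].
  - by rewrite /= sym eyz.
have [/existsP[z /and3P[zJ exz zn]]|nx] :=
    boolP [exists z, [&& z \in J, e x z & z \notin x :: s]].
  exact: (ext x s) zJ exz zn.
have [/existsP[z /and3P[zJ exz zn]]|nl] :=
    boolP [exists z, [&& z \in J, e (last x s) z & z \notin x :: s]].
  apply: (ext (last x s) (rev (belast x s))) zJ exz zn; last by rewrite rev_path_sym.
  by rewrite -rev_rcons -lastI perm_sym perm_rev.
have [||c pc cyc] := close x s Us Ks sJ sz pth.
- move=> z zJ exz; apply: contraNT nx => zn; apply/existsP; exists z; exact/and3P.
- move=> z zJ exz; apply: contraNT nl => zn; apply/existsP; exists z; exact/and3P.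
have mc := perm_mem pc.
have [/existsP[y /andP[yc /existsP[z /and3P[zJ eyz zn]]]]|ncl] :=
    boolP [exists y, (y \in c) && [exists z, [&& z \in J, e y z & z \notin c]]].
  have [i r Er] := rot_to yc.
  apply: (ext y r) zJ eyz _; last by rewrite mc.
    by rewrite -Er (perm_trans pc) // perm_sym perm_rot.
  by move: cyc; rewrite -(rot_cycle i) Er /cycle rcons_path => /andP[].
exists c; split; split=> //.
- by rewrite -size_eq0 -(perm_size pc).
- by rewrite -(perm_uniq pc).
- by move=> z /Ks; rewrite mc.
- by move=> z; rewrite -mc => /sJ.
- by rewrite -(perm_size pc).
move=> y z yc zJ eyz; apply: contraNT ncl => zn; apply/existsP; exists y.
by rewrite yc; apply/existsP; exists z; apply/and3P.
Qed.

Lemma clique_path e K x s : uniq (x :: s) -> {subset x :: s <= K} ->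
  path (add_clique e K) x s.
Proof.
elim: s x => //= y s IH x /andP[xn Us] sK.
rewrite IH ?andbT // => [|z zs]; last by rewrite sK // inE zs orbT.
rewrite /add_clique !sK ?mem_head ?inE ?eqxx ?orbT //=.
by move: xn; rewrite inE negb_or => /andP[-> _]; rewrite orbT.
Qed.

Lemma clique_cycle e K s : 1 < size s -> uniq s -> {subset s <= K} ->
  cycle (add_clique e K) s.
Proof.
case: s => // x s sz Us sK; rewrite /cycle rcons_path clique_path //=.
have ls : last x s \in s by case: s sz {Us sK} => // y s _; rewrite /= mem_last.
rewrite /add_clique !sK ?mem_head ?inE ?ls ?orbT //=.
by rewrite (memPn (proj1 (andP Us))) ?orbT.
Qed.

Variables (e : rel T) (k t : nat).
Hypotheses (sym : symmetric e) (irr : irreflexive e) (kt : k <= t.*2.+2).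
Hypothesis no_path : forall s, uniq s -> sorted e s -> size s != k.+1.

(** Inside A every two vertices have degree sum at least 2t+2 >= k, so a longest
    path closes into a cycle which then is a union of components of A. *)
Lemma core_clique A : A != set0 -> (forall v, v \in A -> t < deg e A v) ->
  exists K, [/\ free_clique e k K, t.+2 <= #|K| & #|K| <= k].
Proof.
case/set0Pn=> a aA dA; have [k0|k_gt0] := posnP k.
  by have := @no_path [:: a] isT isT; rewrite k0.
have [||||||||c [[cn0 Uc _ cA szc] [_ clo]]] :=
    @longest_closed_cycle e k A set0 [:: a] sym.
- by [].
- by [].
- by move=> z; rewrite inE.
- by move=> z; rewrite inE => /eqP->.
- by [].
- by [].
- by move=> s Us _ _; apply: no_path.
- move=> x s Us _ sA sz pth nx nl.
  apply: (@ore_cycle T e) => //.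
  have lA : last x s \in A by rewrite sA // mem_last.
  have xA : x \in A by rewrite sA // mem_head.
  have := closed_deg_le_count Us nx; have := closed_deg_le_count Us nl.
  have := dA x xA; have := dA _ lA; lia.
pose K := [set x in c].
have dK v : v \in K -> t < deg e K v.
  rewrite inE => vc; apply: leq_trans (dA v (cA v vc)) _.
  apply/subset_leq_card/subsetP => z; rewrite !inE => /andP[zA evz].
  by rewrite (clo v) // evz.
have cardK : #|K| = size c by rewrite cardsE; apply/card_uniqP.
exists K; split; last by rewrite cardK.
  by apply: core_free_clique => // x /dK; lia.
have [v vK] : exists v, v \in K.
  by case: (c) cn0 @K {dK cardK} => // v r _ K; exists v; rewrite inE mem_head.
have := dK v vK; rewrite (cardsD1 v K) vK => dv; rewrite !ltnS; apply: leq_trans dv _.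
apply/subset_leq_card/subsetP => z; rewrite !inE => /andP[-> evz].
by rewrite andbT; apply: contraTneq evz => ->; rewrite irr.
Qed.

(** For a longest path through K with at most k vertices, in the graph where K is
    a clique: an end in K has degree at least |K|-1, and an end outside K at least
    k+1-|K|, so Ore's condition holds as soon as one end is in K.  When neither is,
    the path can be reversed on an initial segment so as to start in K. *)
Lemma free_clique_closed_cycle K A : free_clique e k K -> t.+2 <= #|K| <= k ->
    K \subset A ->
    (forall u, u \in A -> u \notin K -> k < #|K| + deg e A u) ->
  exists c, [/\ uniq c, {subset K <= c}, {subset c <= A} & size c <= k] /\
    forall x z, x \in c -> z \in A -> e x z -> z \in c.
Proof.
move=> [_ fp] /andP[tK Kk] KA dA; set e1 := add_clique e K.
have sym1 : symmetric e1 := add_clique_sym K sym.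
have irr1 : irreflexive e1 := add_clique_irr K irr.
have sub x y : e x y -> e1 x y by move=> exy; rewrite /e1 /add_clique exy.
have [||||||||c [[_ Uc Kc cA szc] [_ clo]]] :=
    @longest_closed_cycle e1 k A K (enum K) sym1.
- by rewrite -size_eq0 -cardE; lia.
- exact: enum_uniq.
- by move=> x; rewrite mem_enum.
- by move=> x; rewrite mem_enum => /(subsetP KA).
- by rewrite -cardE.
- have := enum_uniq (mem K); have : {subset enum K <= K} by move=> x; rewrite mem_enum.
  by case: (enum K) => // x s sK Us; apply: clique_path.
- move=> s Us Ks _ ss; apply/eqP => szs.
  have [||s' ps ss'] := fp s Us Ks; [by rewrite szs | by [] |].
  have := @no_path s'; rewrite -(perm_uniq ps) -(perm_size ps) szs eqxx => H.
  by have := H Us ss'.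
- move=> x s Us Ks sA sz pth nx nl.
  have dK r y : uniq r -> {subset K <= r} -> y \in K -> #|K|.-1 <= count (e1 y) r.
    move=> Ur Kr yK; apply: leq_trans (deg_add_clique e yK (subxx K)) _.
    exact: deg_le_count.
  have dU y : y \in x :: s -> y \notin K -> (forall z, z \in A -> e1 y z -> z \in x :: s) ->
      k < #|K| + count (e1 y) (x :: s).
    move=> ys yK ny; apply: leq_trans (dA y (sA y ys) yK) _; rewrite leq_add2l.
    apply: leq_trans (closed_deg_le_count Us ny).
    by apply/subset_leq_card/subsetP => z; rewrite !inE => /andP[-> /sub].
  have dl := @dU (last x s) (mem_last _ _) ^~ nl.
  have dx := @dU x (mem_head _ _) ^~ nx.
  have [xK|xK] := boolP (x \in K).
    apply: (@ore_cycle T e1) => //; have := dK _ x Us Ks xK.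
    have [lK|/dl] := boolP (last x s \in K); last by lia.
    by have := dK _ _ Us Ks lK; lia.
  have [lK|lK] := boolP (last x s \in K).
    by apply: (@ore_cycle T e1) => //; have := dK _ _ Us Ks lK; have := dx xK; lia.
  (* At most k-1 steps, |K| of which leave a vertex of K and k+1-|K| of which
     enter a neighbour of x: some step y z does both, and reversing the part up
     to y makes y the first vertex. *)
  have cK : #|K| <= count (mem K) (belast x s).
    have <- : count (mem K) (x :: s) = count (mem K) (belast x s).
      by rewrite lastI -cats1 count_cat /= (negbTE lK) !addn0.
    rewrite -size_filter -(card_uniqP (filter_uniq _ Us)).
    apply/subset_leq_card/subsetP => z zK; rewrite mem_filter.
    by apply/andP; split; last exact: Ks.
  have [|p [y [z [q [E yK exz]]]]] := @adjacent_pigeonhole _ (e1 x) (mem K) x s.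
    by have := dx xK; rewrite /= irr1; lia.
  case: p E => [|x' p] [Ex Es]; first by move: yK; rewrite -Ex /= (negbTE xK).
  subst x'.
  have ps : perm_eq (y :: rev (x :: p) ++ z :: q) (x :: s).
    rewrite Es -[x :: (p ++ _)]/((x :: p) ++ y :: (z :: q)) -(cat_rcons y) -cat_cons.
    by rewrite -rev_rcons perm_cat2r perm_rev.
  have [||c pc cc] := @ore_cycle T e1 y (rev (x :: p) ++ z :: q) sym1 irr1.
  + move: pth; rewrite Es -cat_rcons cat_path last_rcons => /andP[p1 p2].
    rewrite cat_path -[rev _]/(rev (x :: p)).
    have -> : path e1 y (rev (x :: p)).
      have := rev_path_sym x (rcons p y) sym1; rewrite p1 last_rcons belast_rcons.
      by move->.
    rewrite rev_cons last_rcons /= exz.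
    by move: p2 => /= /andP[].
  + rewrite !(permP ps) /= -[(size _).+1]/(size (y :: rev (x :: p) ++ z :: q)).
    rewrite (perm_size ps) -[_ + count _ s]/(count (e1 y) (x :: s)).
    have -> : last y (rev (x :: p) ++ z :: q) = last x s by rewrite Es !last_cat.
    rewrite -[_ + count _ s]/(count (e1 (last x s)) (x :: s)).
    by have := dK _ y Us Ks yK; have := dl lK; rewrite /=; lia.
  by exists c => //; apply: perm_trans pc; rewrite perm_sym.
exists c; split=> // x z xc zA /sub; exact: clo.
Qed.

(** If an admissible set B has an edge between K and its complement in B, the
    closed cycle through K inside B contains a new vertex, and its vertex set is
    again free, as it contains the neighbours in B of its vertices.  So a largest
    free K admits no such edge. *)
Lemma kopylov_core A : A != set0 -> (forall v, v \in A -> t < deg e A v) ->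
  exists K c, [/\ uniq c, c =i K, cycle e c & t.+2 <= #|K| <= k] /\
    forall B, K \subset B -> (forall u, u \in B -> u \notin K -> k < #|K| + deg e B u) ->
    forall x u, x \in K -> u \in B -> u \notin K -> ~~ e x u.
Proof.
move=> An0 dA; have [K [fK tK Kk]] := core_clique An0 dA.
have [b] := ubnP (k - #|K|); elim: b K fK tK Kk => // b IH K fK tK Kk lt.
pose grows B := [&& K \subset B, [forall u in B, (u \notin K) ==> (k < #|K| + deg e B u)]
  & [exists x in K, exists u in B, (u \notin K) && e x u]].
have [/existsP[B /and3P[KB /forall_inP dB
  /exists_inP[x xK /exists_inP[u uB /andP[uK exu]]]]]|nB] := boolP [exists B, grows B].
  have dB' v : v \in B -> v \notin K -> k < #|K| + deg e B v by move/dB/implyP.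
  have [|c [[Uc Kc cB szc] clo]] := free_clique_closed_cycle fK _ KB dB'.
    by rewrite tK.
  have cardC : #|[set x in c]| = size c by rewrite cardsE; apply/card_uniqP.
  have KC : K \proper [set x in c].
    apply/properP; split; first by apply/subsetP => z /Kc; rewrite inE.
    by exists u => //; rewrite inE (clo x) // Kc.
  have ltC := proper_card KC.
  apply: (IH [set x in c]); [|lia|lia|lia].
  apply: absorb_free_clique (fK) (proper_sub KC) _ _; [exact: sym|exact: irr|lia|].
  move=> v; rewrite inE => vc vK; apply: leq_trans (dB' v (cB v vc) vK) _.
  rewrite leq_add2l; apply/subset_leq_card/subsetP => z; rewrite !inE => /andP[zB evz].
  by rewrite (clo v) // evz.
have [|||c pc cc] := fK.1 (enum K) (enum_uniq _).
- by move=> x; rewrite mem_enum.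
- by rewrite -cardE.
- apply: clique_cycle (enum_uniq _) _; first by rewrite -cardE; lia.
  by move=> x; rewrite mem_enum.
exists K, c; split; first split=> //.
- by rewrite -(perm_uniq pc) enum_uniq.
- by move=> x; rewrite -(perm_mem pc) mem_enum.
- by rewrite tK.
move=> B KB dB x u xK uB uK; apply: contra nB => exu; apply/existsP; exists B.
apply/and3P; split=> //; first by apply/forall_inP => v vB; apply/implyP/dB.
by apply/exists_inP; exists x => //; apply/exists_inP; exists u; rewrite ?uK.
Qed.

End Kopylov.

(** * Hall's theorem and the graph of matched pairs *)

(** Rado's proof.  If the neighbourhoods are shrunk while Hall's condition
    survives, they end up as disjoint singletons.  Shrinking is always possible:
    if a has two neighbours, neither of which can be dropped, two deficient sets
    S1 and S2 appear, both containing a, and the submodularity of the size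
    of the neighbourhood contradicts Hall's condition for their union or for
    their intersection without a. *)
Lemma hall (I B : finType) (b0 : B) (N : I -> {set B}) (A : {set I}) :
    (forall S : {set I}, S \subset A -> #|S| <= #|\bigcup_(i in S) N i|) ->
  exists2 f : I -> B, {in A, forall i, f i \in N i} & {in A &, injective f}.
Proof.
have [b] := ubnP (\sum_(i in A) #|N i|); elim: b N => // b IH N lt hN.
have [/exists_inP[a aA Na]|/exists_inPn small] := boolP [exists a in A, 1 < #|N a|]; last first.
  have N1 i : i \in A -> exists y, N i = [set y].
    move=> iA; apply/cards1P; rewrite eqn_leq leqNgt small //=.
    by have := hN [set i]; rewrite sub1set iA big_set1 cards1; apply.
  exists (fun i => odflt b0 [pick y in N i]).
    by move=> i /N1[y ->]; case: pickP => //= /(_ y); rewrite inE eqxx.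
  move=> i j iA jA; have [y Ni] := N1 i iA; have [z Nj] := N1 j jA.
  rewrite Ni Nj; case: pickP => [y'|/(_ y)]; rewrite ?inE ?eqxx // => /eqP->.
  case: pickP => [z'|/(_ z)]; rewrite ?inE ?eqxx //= => /eqP-> eyz.
  apply/eqP/negPn/negP => nij; have := hN [set i; j].
  rewrite subUset !sub1set iA jA => /(_ isT); rewrite cards2 nij.
  have -> : \bigcup_(l in [set i; j]) N l = [set y].
    by rewrite big_setU1 ?inE //= big_set1 Ni Nj eyz setUid.
  by rewrite cards1.
have [b1 [b2 [b1N b2N nb]]] : exists b1 b2, [/\ b1 \in N a, b2 \in N a & b1 != b2].
  have /card_gt0P[b1 b1N] : 0 < #|N a| by apply: ltnW.
  have : 0 < #|N a :\ b1| by rewrite [#|N a|](cardsD1 b1) b1N in Na.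
  by case/card_gt0P => b2; rewrite !inE => /andP[? ?]; exists b1, b2; rewrite eq_sym.
pose M c i := if i == a then N a :\ c else N i.
have MN c i : M c i \subset N i by rewrite /M; case: eqP => // ->; apply: subD1set.
have red c : c \in N a ->
    (forall S : {set I}, S \subset A -> #|S| <= #|\bigcup_(i in S) M c i|) ->
    exists2 f : I -> B, {in A, forall i, f i \in N i} & {in A &, injective f}.
  move=> cN hM; have [|f fM fi] := IH (M c) _ hM.
    rewrite -ltnS; apply: leq_trans lt; rewrite ltnS.
    rewrite (bigD1 a) // [X in _ < X](bigD1 a) //= -addSn leq_add //.
      by rewrite /M eqxx [X in _ <= X](cardsD1 c) cN.
    by apply: leq_sum => i _; apply/subset_leq_card.
  by exists f => // i /fM; apply/subsetP.
have viol c : [forall S : {set I}, (S \subset A) ==> (#|S| <= #|\bigcup_(i in S) M c i|)] \/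
    exists S : {set I}, S \subset A /\ #|\bigcup_(i in S) M c i| < #|S|.
  case: (boolP [forall S : {set I}, _]) => [|/forallPn[S]]; first by left.
  by rewrite negb_imply -ltnNge => /andP[? ?]; right; exists S.
have [h1|[S1 [S1A lt1]]] := viol b1.
  by apply: (red b1) => // S SA; apply: (implyP (forallP h1 S)).
have [h2|[S2 [S2A lt2]]] := viol b2.
  by apply: (red b2) => // S SA; apply: (implyP (forallP h2 S)).
have aS c (S : {set I}) : S \subset A -> #|\bigcup_(i in S) M c i| < #|S| -> a \in S.
  move=> SA; apply: contraTT => aS; rewrite -leqNgt.
  have /leq_trans-> // := hN S SA; apply/subset_leq_card/bigcupsP => i iS.
  apply: subset_trans (bigcup_sup i iS); rewrite /M ifN //.
  by apply: contraNneq aS => <-.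
have a1 := aS _ _ S1A lt1; have a2 := aS _ _ S2A lt2.
set U1 := \bigcup_(i in S1) M b1 i in lt1; set U2 := \bigcup_(i in S2) M b2 i in lt2.
have leU : #|S1 :|: S2| <= #|U1 :|: U2|.
  apply: leq_trans (hN _ _) _; first by rewrite subUset S1A.
  apply/subset_leq_card/bigcupsP => i iS.
  have [->|nia] := eqVneq i a.
    apply/subsetP => y yN; have [yb|yb] := eqVneq y b1.
      apply/setUP; right; apply/bigcupP; exists a => //.
      by rewrite /M eqxx !inE yb nb -yb.
    apply/setUP; left; apply/bigcupP; exists a => //.
    by rewrite /M eqxx !inE yb.
  have EM c : N i = M c i by rewrite /M ifN.
  case/setUP: iS => iS.
    by rewrite (EM b1); apply: subset_trans (subsetUl _ _); apply: bigcup_sup.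
  by rewrite (EM b2); apply: subset_trans (subsetUr _ _); apply: bigcup_sup.
have leI : #|S1 :&: S2| <= #|U1 :&: U2|.+1.
  rewrite (cardsD1 a) !inE a1 a2 ltnS; apply: leq_trans (hN _ _) _.
    by apply: subset_trans (subD1set _ _) (subset_trans (subsetIl _ _) S1A).
  apply/subset_leq_card/bigcupsP => i; rewrite !inE => /and3P[nia i1 i2].
  have EM c : N i = M c i by rewrite /M ifN.
  by rewrite subsetI {1}(EM b1) (EM b2) !bigcup_sup.
have := cardsUI S1 S2; have := cardsUI U1 U2; lia.
Qed.

Section Decomposition.
Variable T : finType.
Implicit Types (E X D Bl : {set {set T}}) (e p : {set T}).

Definition pairs e := [set p : {set T} | (#|p| == 2) && (p \subset e)].

(** X is chosen with the largest deficiency |X| - |pairs inside X|.  Then Hall's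
    condition holds in both directions: hyperedges outside X inject into the
    pairs not inside X, since otherwise adding the offending ones to X would
    increase the deficiency, and pairs inside X inject into X, since otherwise
    removing the few hyperedges around the offending pairs would. *)
Lemma matching_decomposition E : exists X D Bl (mu : {set T} -> {set T}),
  [/\ X \subset E, Bl \subset D, #|E| = #|X| + #|Bl| & {in D &, injective mu}] /\
  [/\ forall p, p \in D -> #|p| = 2, forall p, p \in D -> mu p \in E,
      forall p, p \in D -> p \subset mu p
    & forall e p, e \in X -> p \subset e -> #|p| = 2 -> p \in D /\ p \notin Bl].
Proof.
pose NP X := \bigcup_(e in X) pairs e.
pose M := #|{set T}|.
have NPM X : #|NP X| <= M by apply: max_card.
case: (@arg_maxnP _ set0 (fun X => X \subset E) (fun X => #|X| + M - #|NP X|)) => [|X XE maxX].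
  exact: sub0set.
have [f1 f1N f1i] : exists2 f : {set T} -> {set T},
    {in E :\: X, forall e, f e \in pairs e :\: NP X} & {in E :\: X &, injective f}.
  apply: (hall set0) => S SA.
  have SX : [disjoint X & S].
    rewrite disjoint_sym; apply/pred0P => e /=; apply/negP => /andP[/(subsetP SA)].
    by rewrite inE => /andP[/negbTE->].
  have := maxX (X :|: S); rewrite subUset XE (subset_trans SA (subsetDl _ _)) => /(_ isT).
  have -> : #|X :|: S| = #|X| + #|S| by apply/eqP; rewrite (leq_card_setU X S).2.
  have le : #|NP (X :|: S)| <= #|NP X| + #|\bigcup_(e in S) (pairs e :\: NP X)|.
    apply: leq_trans (leq_card_setU _ _); apply/subset_leq_card/bigcupsP => e.
    case/setUP=> eS; apply/subsetP => p pe.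
      by apply/setUP; left; apply/bigcupP; exists e.
    have [pX|pX] := boolP (p \in NP X); first by rewrite inE pX.
    by apply/setUP; right; apply/bigcupP; exists e => //; rewrite inE pX.
  have := NPM X; have := NPM (X :|: S); lia.
have [f2 f2N f2i] : exists2 f : {set T} -> {set T},
    {in NP X, forall p, f p \in [set e in X | p \subset e]} & {in NP X &, injective f}.
  apply: (hall set0) => S SN; set U := \bigcup_(i in S) _.
  have UX : U \subset X by apply/bigcupsP => p _; apply/subsetP => e; rewrite inE => /andP[].
  have max1 := maxX (X :\: U) (subset_trans (subsetDl _ _) XE).
  have cXU := cardsD X U; rewrite (setIidPr UX) in cXU.
  have leU := subset_leq_card UX.
  have leN : #|NP (X :\: U)| <= #|NP X :\: S|.
    apply/subset_leq_card/bigcupsP => e; rewrite inE => /andP[eU eX].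
    apply/subsetP => p pe; rewrite inE; apply/andP; split; last by apply/bigcupP; exists e.
    apply: contra eU => pS; apply/bigcupP; exists p => //; rewrite inE eX.
    by move: pe; rewrite inE => /andP[].
  have cNS := cardsD (NP X) S; rewrite (setIidPr SN) in cNS.
  have arith (x u xu n s nu ns m : nat) : xu = x - u -> u <= x -> ns = n - s -> s <= n ->
      n <= m -> nu <= ns -> xu + m - nu <= x + m - n -> s <= u by lia.
  exact: (arith _ _ _ _ _ _ _ _ cXU leU cNS (subset_leq_card SN) (NPM X) leN max1).
pose Bl := f1 @: (E :\: X).
pose mu p := if p \in NP X then f2 p else odflt set0 [pick e in E :\: X | f1 e == p].
have muB e : e \in E :\: X -> mu (f1 e) = e.
  move=> eX; have := f1N e eX; rewrite inE /mu => /andP[/negbTE-> _].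
  case: pickP => [e' /andP[eX' /eqP/f1i->]|/(_ e)] //.
  by rewrite eX eqxx.
have muN p : p \in NP X -> (mu p \in X) && (p \subset mu p).
  by move=> pN; rewrite /mu pN; have := f2N p pN; rewrite inE.
have DP p : p \in NP X :|: Bl -> p \in NP X \/ exists2 e, e \in E :\: X & p = f1 e.
  by case/setUP => [|/imsetP[e]]; [left | right; exists e].
exists X, (NP X :|: Bl), Bl, mu; split; split.
- by [].
- exact: subsetUr.
- by rewrite card_in_imset // cardsD (setIidPr XE) subnKC // subset_leq_card.
- move=> p q /DP[pN|[e eX ->]] /DP[qN|[g gX ->]].
  + by rewrite /mu pN qN; apply: f2i.
  + rewrite (muB g) // => H; have := muN p pN; rewrite H.
    by move: gX; rewrite inE => /andP[/negbTE->].
  + rewrite (muB e) // => H; have := muN q qN; rewrite -H.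
    by move: eX; rewrite inE => /andP[/negbTE->].
  + by rewrite !muB // => ->.
- move=> p /DP[/bigcupP[e _]|[e eX ->]]; first by rewrite inE => /andP[/eqP].
  by have := f1N e eX; rewrite !inE => /and3P[_ /eqP].
- move=> p /DP[/muN/andP[/(subsetP XE)] //|[e eX ->]].
  by rewrite muB //; move: eX; rewrite inE => /andP[].
- move=> p /DP[/muN/andP[] //|[e eX ->]].
  by rewrite muB //; have := f1N e eX; rewrite !inE => /and3P[].
move=> e p eX pe p2; have pN : p \in NP X by apply/bigcupP; exists e => //; rewrite inE p2 eqxx.
split; first by rewrite inE pN.
by apply/imsetP => -[g gX Ep]; have := f1N g gX; rewrite -Ep inE pN.
Qed.

End Decomposition.

(** * Counting cliques by deleting vertices of small degree *)

(** C(., j) grows by at least 1 at each step once it exceeds the identity. *)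
Lemma bin_add_le a b j : 0 < j -> 'C(a, j) + b <= maxn 'C(a + b, j) (a + b).
Proof.
move=> j0; have [le|lt] := leqP 'C(a, j) a; first by lia.
suff : 'C(a, j) + b <= 'C(a + b, j) by lia.
elim: b => [|b IH]; first by rewrite !addn0.
case: j j0 lt IH => // j _ lt IH; rewrite !addnS binS.
have : 0 < 'C(a + b, j); last by lia.
have : 0 < 'C(a, j.+1) by lia.
by rewrite !bin_gt0; lia.
Qed.

Lemma sum_indicator (T : finType) (A : {set T}) (P : pred T) :
  \sum_(y in A) P y = #|[set y in A | P y]|.
Proof. by rewrite -sum1dep_card [RHS]big_mkcondr; apply: eq_bigr => y _; case: (P y). Qed.

Lemma bin_set_superset (T : finType) (S p : {set T}) (r : nat) : p \subset S -> #|p| <= r ->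
  'C(#|S| - #|p|, r - #|p|) <= #|[set y : {set T} | [&& y \subset S, #|y| == r & p \subset y]]|.
Proof.
move=> pS pr; have -> : #|S| - #|p| = #|S :\: p| by rewrite cardsD (setIidPr pS).
rewrite -cards_draws -(card_in_imset (f := fun z => z :|: p)).
  apply/subset_leq_card/subsetP => y /imsetP[z]; rewrite !inE => /andP[zS /eqP cz] ->.
  rewrite subsetUr subUset pS (subset_trans zS (subsetDl _ _)) /=.
  rewrite cardsU cz; have -> : z :&: p = set0; last by rewrite cards0 subn0 subnK // eqxx.
  apply/eqP; rewrite setI_eq0; move: zS; rewrite subsetD => /andP[]//.
have dis (z : {set T}) : z \subset S :\: p -> (z :|: p) :\: p = z.
  rewrite subsetD => /andP[_ /setDidPl dz].
  by rewrite setDUl setDv setU0.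
move=> z1 z2; rewrite !inE => /andP[/dis d1 _] /andP[/dis d2 _] Ez.
by rewrite -d1 -d2 Ez.
Qed.

Section Counting.
Variables (T : finType) (X Bl D : {set {set T}}) (r : nat).
Hypotheses (r_gt1 : 1 < r) (BlD : Bl \subset D) (D2 : forall p : {set T}, p \in D -> #|p| = 2).
Hypothesis Xr : forall e : {set T}, e \in X -> #|e| = r.
Hypothesis Xclique : forall e p : {set T},
  e \in X -> p \subset e -> #|p| = 2 -> p \in D /\ p \notin Bl.
Implicit Types (A S : {set T}) (u v x y : T).

Definition adj : rel T := fun x y => [set x; y] \in D.

Definition weight A :=
  #|[set e in X | e \subset A]| + #|[set p in Bl | p \subset A]|.

(** Trade each blue pair for the r-sets containing it, none of which is in X.
    A pair lies in C(m-2, r-2) >= C(r, 2) of the r-subsets of an m-set and an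
    r-set contains C(r, 2) pairs, so there are at least as many r-sets
    containing a blue pair as there are blue pairs. *)
Lemma weight_le_bin S : r.+2 <= #|S| -> weight S <= 'C(#|S|, r).
Proof.
move=> rS; set XS := [set e in X | e \subset S]; set P := [set p in Bl | p \subset S].
pose Q := [set y : {set T} | (y \subset S) && (#|y| == r)].
pose Y := [set y in Q | [exists p in P, p \subset y]].
have cQ : #|Q| = 'C(#|S|, r) by rewrite cards_draws.
have P2 p : p \in P -> #|p| = 2 by rewrite inE => /andP[/(subsetP BlD)/D2].
have XY : #|XS| + #|Y| <= #|Q|.
  have /eqP <- : #|XS :|: Y| == #|XS| + #|Y|.
    rewrite (leq_card_setU XS Y).2; apply/pred0P => e /=; apply/negP => /andP[].
    rewrite !inE => /andP[eX _] /andP[_ /exists_inP[p pP pe]].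
    have [_ /negP[]] := Xclique eX pe (P2 p pP).
    by move: pP; rewrite inE => /andP[].
  apply/subset_leq_card/subsetP => e /setUP[]; last by rewrite inE => /andP[].
  by rewrite !inE => /andP[/Xr-> ->]; rewrite eqxx.
have PY : #|P| * 'C(r, 2) <= #|Y| * 'C(r, 2).
  apply: (@leq_trans (\sum_(p in P) \sum_(y in Y) (p \subset y))).
    rewrite -sum_nat_const; apply: leq_sum => p pP; have p2 := P2 p pP.
    rewrite sum_indicator.
    have pS : p \subset S by move: pP; rewrite inE => /andP[].
    apply: (@leq_trans 'C(#|S| - #|p|, r - #|p|)).
      by rewrite p2 -(bin_sub r_gt1) leq_bin2l //; lia.
    apply: leq_trans (bin_set_superset pS _) _; first by rewrite p2.
    apply/subset_leq_card/subsetP => y; rewrite !inE => /and3P[-> -> py].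
    by rewrite py andbT; apply/exists_inP; exists p.
  rewrite exchange_big /= -sum_nat_const; apply: leq_sum => y.
  rewrite !inE => /andP[/andP[_ /eqP <-] _]; rewrite -cards_draws.
  rewrite (sum_indicator P (fun p : {set T} => p \subset y)).
  apply/subset_leq_card/subsetP => p; rewrite inE => /andP[pP py].
  by rewrite inE py P2.
have : #|P| <= #|Y| by rewrite -(leq_pmul2r (_ : 0 < 'C(r, 2))) // bin_gt0.
rewrite /weight -/XS -/P -cQ => PY1; apply: leq_trans XY; by rewrite leq_add2l.
Qed.

(** The neighbours of u split into those joined to it by a blue edge and the
    others; a set of X through u consists of u and r-1 neighbours of the second kind. *)
Lemma weight_delete A u : u \in A ->
  weight A <= weight (A :\ u) + maxn 'C(deg adj A u, r.-1) (deg adj A u).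
Proof.
move=> uA; pose R := [set z in A | adj u z && ([set u; z] \notin Bl)].
pose W := [set z in A | [set u; z] \in Bl].
have cRW : #|R| + #|W| = deg adj A u.
  rewrite /deg -(cardsID W [set z in A | adj u z]) addnC.
  congr (_ + _); apply: eq_card => z; rewrite !inE.
    case: (z \in A) => //=; case: (boolP ([set u; z] \in Bl)); rewrite ?andbF ?andbT //.
    by move/(subsetP BlD).
  by case: (z \in A) => //=; rewrite andbC.
have split_at (F : {set {set T}}) : #|[set e in F | e \subset A]| =
    #|[set e in F | e \subset A :\ u]| + #|[set e in F | (e \subset A) && (u \in e)]|.
  rewrite -(cardsID [set e : {set T} | u \in e] [set e in F | e \subset A]) addnC.
  congr (_ + _); apply: eq_card => e.
    by rewrite !inE subsetD1; case: (e \in F); case: (e \subset A); case: (u \in e).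
  by rewrite !inE andbA.
have cX : #|[set e in X | (e \subset A) && (u \in e)]| <= 'C(#|R|, r.-1).
  rewrite -cards_draws -(card_in_imset (f := fun e : {set T} => e :\ u)
    (D := [set e in X | (e \subset A) && (u \in e)])).
    apply/subset_leq_card/subsetP => y /imsetP[e]; rewrite !inE => /and3P[eX eA ue] ->.
    have := Xr eX; rewrite (cardsD1 u e) ue => <-; rewrite eqxx andbT.
    apply/subsetP => z; rewrite !inE => /andP[zu ze]; rewrite (subsetP eA) //=.
    have [||] := @Xclique e [set u; z] eX; last by rewrite /adj => -> ->.
      by rewrite subUset !sub1set ue.
    by rewrite cards2 eq_sym zu.
  move=> e1 e2; rewrite !inE => /and3P[_ _ u1] /and3P[_ _ u2] E.
  by rewrite -(setD1K u1) E setD1K.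
have cB : #|[set e in Bl | (e \subset A) && (u \in e)]| <= #|W|.
  apply: leq_trans (leq_imset_card (fun z => [set u; z]) _).
  apply/subset_leq_card/subsetP => p; rewrite !inE => /and3P[pB pA up].
  have := D2 (subsetP BlD p pB); rewrite (cardsD1 u p) up => /eqP/cards1P[z Ez].
  have Ep : p = [set u; z] by rewrite -(setD1K up) Ez.
  by apply/imsetP; exists z => //; rewrite inE -Ep pB (subsetP pA) // Ep set22.
rewrite /weight !split_at -cRW.
have := @bin_add_le #|R| #|W| r.-1; lia.
Qed.

(** S is the part that the deletions must not touch, m the size at which they stop. *)
Lemma weight_bound S m d : r.+2 <= m -> #|S| <= m ->
    (forall A, S \subset A -> m < #|A| ->
       exists u, [/\ u \in A, u \notin S & deg adj A u <= d]) ->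
  forall A, S \subset A -> m <= #|A| ->
    weight A <= 'C(m, r) + (#|A| - m) * maxn 'C(d, r.-1) d.
Proof.
move=> rm Sm del A; have [b] := ubnP #|A|; elim: b A => // b IH A lt SA.
rewrite leq_eqVlt => /predU1P[Em|mA].
  by rewrite Em subnn addn0 weight_le_bin // -Em.
have [u [uA uS du]] := del A SA mA.
have cA := cardsD1 u A; rewrite uA in cA.
apply: leq_trans (weight_delete uA) _.
have : maxn 'C(deg adj A u, r.-1) (deg adj A u) <= maxn 'C(d, r.-1) d.
  by rewrite geq_max !leq_max leq_bin2l // du orbT.
have := IH (A :\ u); rewrite subsetD1 SA uS.
have -> : #|A| - m = (#|A :\ u| - m).+1 by lia.
by rewrite mulSn => H; have := H _ isT _; lia.
Qed.

End Counting.

(** * Berge walks *)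

Section Walks.
Variables (T : finType) (E : {set {set T}}).
Implicit Types (K U A : {set T}) (u v w x y z : T) (g h : {set T}) (s c : seq T).
Implicit Types st : seq ({set T} * T).

(** A Berge walk from x is the list of its steps, each made of a hyperedge and
    of the vertex it leads to; distinctness is imposed separately, so that walks can
    be concatenated and cut freely. *)
Fixpoint bwalk x st :=
  if st is (g, v) :: st' then [&& g \in E, x \in g, v \in g & bwalk v st'] else true.

Definition verts st : seq T := map snd st.
Definition hedges st : seq {set T} := map fst st.

Lemma bwalk_cat x st1 st2 :
  bwalk x (st1 ++ st2) = bwalk x st1 && bwalk (last x (verts st1)) st2.
Proof. by elim: st1 x => //= -[g v] st IH x; rewrite IH !andbA. Qed.

Lemma bwalk_nth x st i : bwalk x st -> i < size st ->
  [/\ nth set0 (hedges st) i \in E, nth x (x :: verts st) i \in nth set0 (hedges st) i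
    & nth x (verts st) i \in nth set0 (hedges st) i].
Proof.
elim: st x i => // -[g v] st IH x [|i] /=; first by case/and4P.
case/and4P=> _ _ _ /IH{}IH lt; have [h1 h2 h3] := IH i lt; split=> //.
  by rewrite (set_nth_default v) //= ltnS size_map ltnW.
by rewrite (set_nth_default v) // size_map.
Qed.

Lemma bwalk_berge_path x st l : bwalk x st -> uniq (x :: verts st) ->
  uniq (hedges st) -> l <= size st -> has_berge_path E l.
Proof.
move=> wst Uv Uh le.
exists (fun i : 'I_l.+1 => nth x (x :: verts st) i), (fun i : 'I_l => nth set0 (hedges st) i).
split.
- move=> i j /eqP; rewrite nth_uniq //= ?size_map; first by move/eqP/val_inj.
    by have := ltn_ord i; lia.
  by have := ltn_ord j; lia.
- move=> i j /eqP; rewrite nth_uniq //= ?size_map; first by move/eqP/val_inj.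
    by have := ltn_ord i; lia.
  by have := ltn_ord j; lia.
- by move=> i; have [] := @bwalk_nth x st i wst (leq_trans (ltn_ord i) le).
move=> i; have [_ h1 h2] := @bwalk_nth x st i wst (leq_trans (ltn_ord i) le).
by rewrite subUset !sub1set h1.
Qed.

Lemma connected_bwalk x u : connected_hypergraph E ->
  exists2 st, bwalk x st & last x (verts st) = u.
Proof.
move=> conn; have /connectP[p pp lp] := conn (inl x) (inl u).
suff reach p' (a : T + {g : {set T} | g \in E}) :
    path (@incidence_bigraph T E) a p' -> inl u = last a p' ->
    match a with
    | inl y => exists2 st, bwalk y st & last y (verts st) = u
    | inr g => forall y, y \in val g -> exists2 st, bwalk y st & last y (verts st) = u
    end by exact: (reach p (inl x)).
elim: p' a {p pp lp} => [|b p IH] a /=.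
  by move=> _ <-; exists [::].
case/andP=> ab /IH{}IH /IH; case: a b ab {IH} => [y|g] [v|h] //= yh.
  by apply.
by move=> [st wst lst] y yg; exists ((val g, v) :: st); rewrite //= (valP g) yg yh.
Qed.

Lemma uniq_map_split (I J : eqType) (f : I -> J) (l : seq I) :
    (forall l1 (a : I) l2 b l3, l = l1 ++ a :: l2 ++ b :: l3 -> f a <> f b) ->
  uniq (map f l).
Proof.
elim: l => //= a l IH H; rewrite IH ?andbT => [|l1 b l2 c l3 El]; last first.
  by apply: (H (a :: l1) b l2 c l3); rewrite El.
apply/mapP => -[b bs]; case/splitPr: bs H {IH} => s1 s2 H.
by apply: (H [::] a s1 b s2).
Qed.

(** A walk of least length from K to U is automatically a Berge path.  No
    hyperedge but the first meets K and none but the last meets U: every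
    violation allows a shortcut. *)
Lemma shortest_bwalk K U : connected_hypergraph E -> K != set0 -> U != set0 ->
    [disjoint K & U] ->
  exists x st (e0 ep : {set T}),
   [/\ x \in K, last x (verts st) \in U, 0 < size st, uniq (verts st)
     & uniq (hedges st)] /\
   [/\ x \in e0, last x (verts st) \in ep & (forall y, y \in e0 -> bwalk y st)] /\
   [/\ (forall y g, y \in K -> g \in hedges st -> y \in g -> g = e0),
       (forall y g, y \in U -> g \in hedges st -> y \in g -> g = ep)
     & forall v, v \in verts st -> v \notin K /\ (v \in U -> v = last x (verts st))].
Proof.
move=> conn /set0Pn[x0 x0K] /set0Pn[u0 u0U] dKU.
pose joins n := [exists x in K, [exists st : n.-tuple ({set T} * T),
  bwalk x st && (last x (verts st) \in U)]].
have joinsP x st n : x \in K -> bwalk x st -> last x (verts st) \in U -> size st = n -> joins n.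
  move=> xK wst lU Hs; apply/exists_inP; exists x => //; subst n.
  by apply/existsP; exists (in_tuple st); rewrite wst.
have exj : exists n, joins n.
  have [st wst lst] := connected_bwalk x0 u0 conn.
  by exists (size st); apply: (joinsP x0 st); rewrite ?lst.
case: (ex_minnP exj) => n /exists_inP[x xK /existsP[tst /andP[wst lU]]] minn.
have {minn} mn y st' : y \in K -> bwalk y st' -> last y (verts st') \in U -> size tst <= size st'.
  by move=> yK wst' lU'; rewrite size_tuple; apply: minn; apply: joinsP lU' _.
move: (tval tst : seq ({set T} * T)) mn wst lU => {tst} st mn wst lU.
have sz : 0 < size st.
  by case: st lU {mn wst} => //= xU; have /pred0P/(_ x) /= := dKU; rewrite xK xU.
have st_head : exists e0 v0 st', st = (e0, v0) :: st'.
  by case: (st) sz => // -[g v] st' _; exists g, v, st'.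
have st_last : exists ep vp st', st = rcons st' (ep, vp).
  by case/lastP: (st) sz => // st' [g v] _; exists g, v, st'.
have [e0 [v0 [st0 E0]]] := st_head; have [ep [vp [sti E1]]] := st_last.
have lastE : last x (verts st) = vp by rewrite E1 /verts map_rcons last_rcons.
have cutP st1 g v st2 : st = st1 ++ (g, v) :: st2 ->
    [/\ bwalk x st1, g \in E, last x (verts st1) \in g, v \in g & bwalk v st2].
  by move=> Es; move: wst; rewrite Es bwalk_cat /= => /and5P[].
have lastc st1 g v st2 : st = st1 ++ (g, v) :: st2 -> last v (verts st2) = last x (verts st).
  by move=> ->; rewrite /verts map_cat last_cat.
have hsplit g : g \in hedges st -> exists st1 v st2, st = st1 ++ (g, v) :: st2.
  by case/mapP=> -[g' v] /= Hm ->; case/splitPr: Hm => st1 st2; exists st1, v, st2.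
have vsplit v : v \in verts st -> exists st1 g st2, st = st1 ++ (g, v) :: st2.
  by case/mapP=> -[g v'] /= Hm ->; case/splitPr: Hm => st1 st2; exists st1, g, st2.
have Uhit y st1 g v st2 : st = st1 ++ (g, v) :: st2 -> y \in g -> y \in U -> st2 = [::].
  move=> Es yg yU; have [w1 gE xg vg w2] := cutP _ _ _ _ Es.
  have := mn x (rcons st1 (g, y)) xK.
  rewrite /verts map_rcons last_rcons -cats1 bwalk_cat /= w1 gE xg yg.
  move=> /(_ isT yU); rewrite Es !size_cat /=; by case: (st2) => //= p l; clear; lia.
exists x, st, e0, ep; split; [split | split; split] => //.
- apply: uniq_map_split => st1 [g v] st2 [h w] st3 Es /= Evw; subst w.
  have [w1 gE xg vg w2] := cutP _ _ _ _ Es.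
  have Es' : st = (st1 ++ (g, v) :: st2) ++ (h, v) :: st3 by rewrite Es -catA.
  have [_ _ _ _ w3] := cutP _ _ _ _ Es'.
  have := mn x (st1 ++ (g, v) :: st3) xK; rewrite bwalk_cat /= w1 gE xg vg w3.
  rewrite {1}/verts map_cat last_cat /= -/(verts _) (lastc _ _ _ _ Es') lU => /(_ isT isT).
  by rewrite Es !size_cat /= !size_cat /=; clear; lia.
- apply: uniq_map_split => st1 [g v] st2 [h w] st3 Es /= Egh; subst h.
  have [w1 gE xg vg w2] := cutP _ _ _ _ Es.
  have Es' : st = (st1 ++ (g, v) :: st2) ++ (g, w) :: st3 by rewrite Es -catA.
  have [_ _ _ wg w3] := cutP _ _ _ _ Es'.
  have := mn x (st1 ++ (g, w) :: st3) xK; rewrite bwalk_cat /= w1 gE xg wg w3.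
  rewrite {1}/verts map_cat last_cat /= -/(verts _) (lastc _ _ _ _ Es') lU => /(_ isT isT).
  by rewrite Es !size_cat /= !size_cat /=; clear; lia.
- by have [] := cutP [::] e0 v0 st0 E0.
- by have [] := cutP sti ep vp [::]; rewrite ?cats1 // lastE.
- move=> y ye; have [_ e0E _ ve w2] := cutP [::] e0 v0 st0 E0.
  by rewrite E0 /= e0E ye ve.
- move=> y g yK /hsplit[st1 [v [st2 Es]]] yg.
  have [w1 gE xg vg w2] := cutP _ _ _ _ Es.
  have := mn y ((g, v) :: st2) yK; rewrite /= gE yg vg w2 (lastc _ _ _ _ Es) lU => /(_ isT isT).
  rewrite Es size_cat /=; case: st1 Es {w1 xg} => [|[? ?] st1] Es /=; last by clear; lia.
  by move: Es; rewrite E0 => -[->].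
- move=> y g yU /hsplit[st1 [v [st2 Es]]] yg.
  have st20 := Uhit y _ _ _ _ Es yg yU.
  by move: Es; rewrite st20 E1 cats1 => /rcons_inj[_ -> _].
move=> v /vsplit[st1 [g [st2 Es]]]; have [w1 gE xg vg w2] := cutP _ _ _ _ Es; split.
  apply/negP => vK; have := mn v st2 vK w2; rewrite (lastc _ _ _ _ Es) lU => /(_ isT).
  by rewrite Es size_cat /=; clear; lia.
move=> vU; rewrite -(lastc _ _ _ _ Es).
by rewrite (Uhit v _ _ _ _ Es vg vU).
Qed.

Variables (D : {set {set T}}) (mu : {set T} -> {set T}).
Hypotheses (D2 : forall p : {set T}, p \in D -> #|p| = 2)
  (muE : forall p : {set T}, p \in D -> mu p \in E)
  (mu_sub : forall p : {set T}, p \in D -> p \subset mu p)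
  (mu_inj : {in D &, injective mu}).

Lemma adj_sym : symmetric (adj D).
Proof. by move=> x y; rewrite /adj setUC. Qed.

Lemma adj_irr : irreflexive (adj D).
Proof. by move=> x; apply/negP => /D2; rewrite setUid cards1. Qed.

(** The Berge walk that follows a path of the graph of matched pairs. *)
Fixpoint lift_path x s := if s is y :: s' then (mu [set x; y], y) :: lift_path y s' else [::].

Lemma verts_lift_path x s : verts (lift_path x s) = s.
Proof. by elim: s x => //= y s IH x; rewrite IH. Qed.

Lemma size_lift_path x s : size (lift_path x s) = size s.
Proof. by rewrite -{2}(verts_lift_path x s) size_map. Qed.

Lemma bwalk_lift_path x s : path (adj D) x s -> bwalk x (lift_path x s).
Proof.
elim: s x => //= y s IH x /andP[xy /IH->]; rewrite muE // andbT.
by rewrite !(subsetP (mu_sub xy)) // ?set21 ?set22.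
Qed.

Lemma hedges_lift_path x s g : path (adj D) x s -> g \in hedges (lift_path x s) ->
  exists a b, [/\ a \in x :: s, b \in x :: s, adj D a b & g = mu [set a; b]].
Proof.
elim: s x => //= y s IH x /andP[xy ps]; rewrite inE => /predU1P[->|/(IH y ps)].
  by exists x, y; rewrite !inE !eqxx orbT.
case=> a [b [ma mb ab ->]]; exists a, b; split=> //; first by rewrite inE ma orbT.
by rewrite inE mb orbT.
Qed.

Lemma uniq_hedges_lift_path x s : path (adj D) x s -> uniq (x :: s) ->
  uniq (hedges (lift_path x s)).
Proof.
elim: s x => //= y s IH x /andP[xy ps] /and3P[xn yn Us]; rewrite IH //= ?yn // andbT.
apply/negP => /(hedges_lift_path ps)[a [b [ma mb ab /(mu_inj xy ab) Es]]].
have : x \in [set a; b] by rewrite -Es set21.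
by rewrite !inE => /orP[]/eqP Ex; move: xn; rewrite Ex ?ma ?mb.
Qed.

(** The graph without the pair matched to the hyperedge h, which frees h for use
    as a link elsewhere. *)
Definition avoid h : rel T := fun a b => adj D a b && (mu [set a; b] != h).

Lemma avoid_sym h : symmetric (avoid h).
Proof. by move=> a b; rewrite /avoid adj_sym setUC. Qed.

Lemma avoid_path h x s : path (avoid h) x s -> path (adj D) x s /\ h \notin hedges (lift_path x s).
Proof.
elim: s x => //= y s IH x /andP[/andP[xy ne] /IH[ps nh]]; rewrite xy ps inE negb_or nh andbT.
by split; rewrite // andbT eq_sym.
Qed.

(** If h is matched to an edge of the cycle, opening the cycle at this very edge
    gives a path that does not use h and ends in h; if not, it may be
    opened next to z. *)
Lemma cycle_open_at h c z : uniq c -> 2 < size c -> cycle (adj D) c -> z \in c -> z \in h ->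
  exists x s, [/\ perm_eq c (x :: s), path (adj D) x s, last x s \in h
    & h \notin hedges (lift_path x s)].
Proof.
move=> Uc sz cc zc zh; have [ch|nch] := boolP (cycle (avoid h) c).
  have [i r Er] := rot_to zc.
  have pr : path (avoid h) z r.
    by move: ch; rewrite -(rot_cycle i) Er /cycle rcons_path => /andP[].
  have pr' : path (avoid h) (last z r) (rev (belast z r)).
    by rewrite rev_path_sym //; apply: avoid_sym.
  exists (last z r), (rev (belast z r)); have [p1 p2] := avoid_path pr'; split=> //.
    rewrite -rev_rcons -lastI perm_sym perm_rev -Er perm_rot //.
  by rewrite last_rev_belast.
have [i [x [s [Er ne]]]] := cycle_gap nch.
have pc : perm_eq c (x :: s) by rewrite -Er perm_sym perm_rot.
move: cc; rewrite -(rot_cycle i) Er /cycle rcons_path => /andP[ps lx].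
have Eh : mu [set last x s; x] = h by move: ne; rewrite /avoid lx negbK => /eqP.
exists x, s; split=> //; first by rewrite -Eh (subsetP (mu_sub lx)) // set21.
have Us : uniq (x :: s) by rewrite -(perm_uniq pc).
rewrite (perm_size pc) in sz.
case: s ps lx Eh Us sz {ne pc Er} => // y s /= /andP[xy ps] lx Eh /and3P[xn yn Us] sz.
rewrite inE negb_or; apply/andP; split.
  rewrite -Eh; apply/eqP => /(mu_inj lx xy) Es.
  have : y \in [set last y s; x] by rewrite Es set22.
  rewrite !inE => /orP[/eqP Ey|/eqP Ey]; last by move: xn; rewrite inE Ey eqxx.
  by case: s sz yn Ey {ps lx Eh Us xn Es} => //= w s _ yn Ey; move: yn; rewrite Ey mem_last.
rewrite -Eh; apply/negP => /(hedges_lift_path ps)[a [b [ma mb ab /(mu_inj lx ab) Es]]].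
have : x \in [set a; b] by rewrite -Es set22.
by rewrite !inE => /orP[]/eqP Ex; move: xn; rewrite Ex ?ma ?mb.
Qed.

Lemma avoid_deg h U u : (deg (adj D) U u).-1 <= deg (avoid h) U u.
Proof.
have [/existsP[z /andP[uz /eqP zh]]|no] := boolP [exists z, adj D u z && (mu [set u; z] == h)].
  rewrite /deg [X in X.-1](cardsD1 z); case: (_ \in _).
    apply/subset_leq_card/subsetP => y; rewrite !inE /avoid => /and3P[yz -> uy].
    rewrite uy -zh /=; apply: contra yz => /eqP/(mu_inj uy uz) Es.
    have : y \in [set u; z] by rewrite -Es set22.
    rewrite !inE => /orP[/eqP Eu|//]; by move: uy; rewrite Eu adj_irr.
  apply: leq_trans (leq_pred _) _.
  apply/subset_leq_card/subsetP => y; rewrite !inE /avoid => /and3P[yz -> uy].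
  rewrite uy -zh /=; apply: contra yz => /eqP/(mu_inj uy uz) Es.
  have : y \in [set u; z] by rewrite -Es set22.
  rewrite !inE => /orP[/eqP Eu|//]; by move: uy; rewrite Eu adj_irr.
apply: leq_trans (leq_pred _) _.
apply/subset_leq_card/subsetP => y; rewrite !inE /avoid => /andP[-> uy]; rewrite uy /=.
by apply: contra no => Ey; apply/existsP; exists y; rewrite uy.
Qed.

(** Avoiding h costs at most one neighbour per vertex; hence the predecessors in
    the degree condition. *)
Lemma path_from_avoiding h U a w : w \in U -> (forall u, u \in U -> a <= (deg (adj D) U u).-1) ->
  exists s, [/\ path (avoid h) w s, uniq (w :: s), {subset w :: s <= U} & size s = a].
Proof.
move=> wU dU; have {}dU u : u \in U -> a <= deg (avoid h) U u.
  by move/dU=> le; apply: leq_trans le (avoid_deg _ _ _).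
suff : forall n, n <= a -> exists s,
  [/\ path (avoid h) w s, uniq (w :: s), {subset w :: s <= U} & size s = n] by apply.
elim=> [|n IH] le.
  by exists [::]; split=> // z; rewrite inE => /eqP->.
have [s [ps Us sU Es]] := IH (ltnW le).
have lU : last w s \in U by rewrite sU // mem_last.
have : n < deg (avoid h) U (last w s) by apply: leq_trans le (dU _ lU).
have [/existsP[z /and3P[zU lz zn]]|no] :=
    boolP [exists z, [&& z \in U, avoid h (last w s) z & z \notin w :: s]].
  move=> _; exists (rcons s z); rewrite rcons_path ps lz size_rcons Es; split=> //.
    by rewrite -rcons_cons rcons_uniq zn Us.
  by move=> y; rewrite -rcons_cons mem_rcons inE => /predU1P[->|/sU].
rewrite ltnNge; case/negP.
rewrite -Es -(size_belast w s) -(card_uniqP (_ : uniq (belast w s))); last first.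
  by move: Us; rewrite lastI rcons_uniq => /andP[].
apply/subset_leq_card/subsetP => z; rewrite inE => /andP[zU lz].
have : z \in w :: s by apply: contraNT no => zn; apply/existsP; exists z; apply/and3P.
rewrite lastI mem_rcons inE => /predU1P[Ez|//].
by move: lz; rewrite Ez /avoid adj_irr.
Qed.

(** Only the first hyperedge of a shortest link can be matched to a pair inside K,
    and only the last one to a pair inside U.  Opening the cycle at the first and
    avoiding the last in U, one gets size c - 1 steps in K, at least one
    step in the link and a steps in U. *)
Lemma berge_path_from_cycle K U c a : connected_hypergraph E ->
    uniq c -> c =i K -> cycle (adj D) c -> 2 < size c ->
    U != set0 -> [disjoint K & U] ->
    (forall u, u \in U -> a <= (deg (adj D) U u).-1) ->
  has_berge_path E (size c + a).
Proof.
move=> conn Uc cK cc szc Un0 dKU dU.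
have Kn0 : K != set0.
  by case: (c) cK szc => // z r cK _; apply/set0Pn; exists z; rewrite -cK mem_head.
have [x0 [st [e0 [ep [[x0K wU sz_st Uv Uh] [[xe0 wep walk] [hK hU vKU]]]]]]] :=
  shortest_bwalk conn Kn0 Un0 dKU.
set w := last x0 (verts st) in wU wep vKU.
have x0c : x0 \in c by rewrite cK.
have [x [s [pc ps ls nh]]] := cycle_open_at Uc szc cc x0c xe0.
have [s' [pa' Us' sU' Es']] := path_from_avoiding ep wU dU.
have [ps' nh'] := avoid_path pa'.
have sK z : z \in x :: s -> z \in K by rewrite -(perm_mem pc) cK.
have Us : uniq (x :: s) by rewrite -(perm_uniq pc).
have nKU z : z \in K -> z \in U -> False.
  by move=> zK zU; have /pred0P/(_ z) /= := dKU; rewrite zK zU.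
have lw y : last y (verts st) = w.
  by rewrite /w; case: (st) sz_st.
apply: (@bwalk_berge_path x (lift_path x s ++ st ++ lift_path w s')).
- by rewrite !bwalk_cat bwalk_lift_path // verts_lift_path lw walk // bwalk_lift_path.
- rewrite /verts !map_cat -!/(verts _) !verts_lift_path -cat_cons cat_uniq Us /=.
  have Us2 : uniq s' by case/andP: Us'.
  rewrite cat_uniq Uv Us2 andbT /=; apply/andP; split.
    apply/hasPn => z; rewrite mem_cat => zz; apply/negP => /sK zK.
    case/orP: zz => [/vKU[]|zs]; first by rewrite zK.
    by apply: (nKU z) => //; apply: sU'; rewrite inE zs orbT.
  apply/hasPn => z zs; apply/negP => /vKU[_ H].
  have zU : z \in U by apply: sU'; rewrite inE zs orbT.
  by move: Us'; rewrite /= -(H zU) zs.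
- rewrite /hedges !map_cat -!/(hedges _) !cat_uniq !uniq_hedges_lift_path // Uh /= andbT.
  apply/andP; split.
    apply/hasPn => g; rewrite mem_cat => gg; apply/negP => gl.
    have [a1 [b1 [ma mb ab Eg]]] := hedges_lift_path ps gl.
    case/orP: gg => [gst|gl'].
      have Ee : g = e0.
        by apply: (hK a1) => //; [exact: sK | rewrite Eg (subsetP (mu_sub ab)) // set21].
      by move: nh; rewrite -Ee gl.
    have [a2 [b2 [ma2 mb2 ab2 Eg2]]] := hedges_lift_path ps' gl'.
    have Ep : [set a1; b1] = [set a2; b2] by apply: mu_inj; rewrite // -Eg -Eg2.
    have : a1 \in [set a2; b2] by rewrite -Ep set21.
    rewrite !inE => /orP[]/eqP Ea; apply: (nKU a1 (sK _ ma)); rewrite Ea; exact: sU'.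
  apply/hasPn => g gl'; apply/negP => gst.
  have [a2 [b2 [ma2 mb2 ab2 Eg2]]] := hedges_lift_path ps' gl'.
  have Ee : g = ep.
    by apply: (hU a2) => //; [exact: sU' | rewrite Eg2 (subsetP (mu_sub ab2)) // set21].
  by move: nh'; rewrite -Ee gl'.
by rewrite !size_cat !size_lift_path Es' (perm_size pc) /=; move: sz_st; clear; lia.
Qed.

Lemma adj_path_berge x s : path (adj D) x s -> uniq (x :: s) -> has_berge_path E (size s).
Proof.
move=> ps Us; apply: (@bwalk_berge_path x (lift_path x s)); rewrite ?size_lift_path //.
- exact: bwalk_lift_path.
- by rewrite verts_lift_path.
- exact: uniq_hedges_lift_path.
Qed.

End Walks.

(** * Binomial estimates *)

Lemma bin_ge_self t j : 0 < j < t -> t <= 'C(t, j).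
Proof.
elim: t j => // t IH [|j] // /andP[_]; rewrite ltnS leq_eqVlt => /predU1P[->|lt].
  by rewrite binSn.
rewrite binS; have := IH j.+1 lt; have : 0 < 'C(t, j) by rewrite bin_gt0; lia.
lia.
Qed.

Lemma bin_convex x j : ('C(x.+1, j)).*2 <= 'C(x, j) + 'C(x.+2, j).
Proof.
case: j => [|j]; first by rewrite !bin0.
rewrite !binS; have := @leq_bin2l x x.+1 j (leqnSn x); lia.
Qed.

Lemma bin_add_ge x i j : 'C(x, j.+1) + i * 'C(x, j) <= 'C(x + i, j.+1).
Proof.
elim: i => [|i IH]; first by rewrite addn0 addn0.
rewrite addnS binS mulSn; have := @leq_bin2l x (x + i) j (leq_addr _ _); lia.
Qed.

Lemma convex_le_endpoints (phi : nat -> nat) t :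
    (forall a, 0 < a -> a.+2 <= t -> (phi a.+1).*2 <= phi a + phi a.+2) ->
  forall a, 0 < a <= t -> phi a <= maxn (phi 1) (phi t).
Proof.
elim: t => [|t IH] cvx a; first by lia.
have {}IH b : 0 < b <= t -> phi b <= maxn (phi 1) (phi t).
  by apply: IH => c c0 ct; apply: cvx => //; apply: ltnW.
case/andP=> a0; rewrite leq_eqVlt => /predU1P[->|at_]; first by rewrite leq_maxr.
have lea := IH a; rewrite a0 -ltnS at_ in lea; have {}lea := lea isT.
suff : phi t <= maxn (phi 1) (phi t.+1) by lia.
case: t IH cvx at_ {lea} => [|[|t]] IH cvx at_; [by lia | by rewrite leq_maxl | ].
by have := cvx t.+1 isT (leqnn _); have := IH t.+1; lia.
Qed.

(** The bound obtained from a core of size k - a, on k + N vertices. *)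
Definition core_bound N k r a := 'C(k - a, r) + (N + a) * maxn 'C(a, r.-1) a.

Lemma core_bound_convex N k r a : a.+2 <= k ->
  (core_bound N k r a.+1).*2 <= core_bound N k r a + core_bound N k r a.+2.
Proof.
move=> ak; rewrite /core_bound.
have c1 := bin_convex (k - a.+2) r.
have e1 : (k - a.+2).+1 = k - a.+1 by lia.
have e2 : (k - a.+1).+1 = k - a by lia.
rewrite e1 e2 in c1.
have c2 := bin_convex a r.-1.
have := leq_bin2l r.-1 (leqW (leqnSn a)).
move: c1 c2; clear.
move: 'C(k - a.+2, r) 'C(k - a.+1, r) 'C(k - a, r) => x y z.
move: 'C(a, r.-1) 'C(a.+1, r.-1) 'C(a.+2, r.-1) => u v w c1 c2 uw.
have p1 : (maxn v a.+1).*2 <= maxn u a + maxn w a.+2 by lia.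
have p2 : maxn u a <= maxn w a.+2 by lia.
move: p1 p2; move: (maxn u a) (maxn v a.+1) (maxn w a.+2) => p q s p1 p2.
nia.
Qed.

(** At n = k the value at a = t is below the one at a = 1: growing k-t to k-1 takes
    t-1 steps, each adding at least C(t+1, r-1), and
    t C(t, r-1) <= (t-1) (C(t, r-1) + C(t, r-2)). *)
Lemma half_core_le_full_core k t r : 2 < r -> r < t -> t.*2 < k ->
  'C(k - t, r) + t * 'C(t, r.-1) <= 'C(k.-1, r).
Proof.
case: r => [|[|[|m]]] // _ rt tk; rewrite [_.-1]/=.
have := bin_add_ge (k - t) t.-1 m.+2; have -> : k - t + t.-1 = k.-1 by lia.
have := @leq_bin2l t.+1 (k - t) m.+2; have := mul_bin_left t m.+1; rewrite binS.
move: 'C(k - t, _) 'C(k.-1, _) 'C(k - t, _) => x y z.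
move: 'C(t, m.+2) 'C(t, m.+1) => p q e h1 h2.
have {}h1 : p + q <= z by apply: h1; lia.
have h3 : p <= t.-1 * q by nia.
have : t * p <= t.-1 * z; last by lia.
apply: (@leq_trans (t.-1 * (p + q))); last by rewrite leq_mul2l h1 orbT.
have -> : t * p = t.-1 * p + p by rewrite -[in LHS](prednK (ltn_trans _ rt)) // mulSn addnC.
by rewrite mulnDr leq_add2l.
Qed.

Lemma fstar_nat n k r a : a <= k <= n ->
  fstar n k r a = ('C(k - a, r) + (n - k + a) * 'C(a, r.-1))%:Z%R.
Proof.
move=> /andP[ak kn]; rewrite /fstar subn1.
have -> : (n%:Z - k%:Z + a%:Z = (n - k + a)%:Z)%R by lia.
by rewrite -PoszM -PoszD.
Qed.

Section Formula.
Variables (k r : nat).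
Hypotheses (hkr : 4 * r <= k) (hr : 2 < r).
Let t := (k - 1)./2.

Lemma f_fstar_half n : f n k r t = fstar n k r t.
Proof.
rewrite /f /fstar; have -> : minn r (k - t)./2 = r by rewrite /t; lia.
by have -> : minn (r - 1) t./2 = r - 1 by rewrite /t; lia.
Qed.

Lemma f_one n : k <= n -> f n k r 1 = ('C(k.-1, r) + (n - k + 1))%:Z%R.
Proof.
move=> kn; rewrite /f subn1; have -> : minn r (k.-1)./2 = r by lia.
have -> : minn (r - 1) 1./2 = 0 by rewrite /= minn0.
by rewrite bin0; lia.
Qed.

(** The slope in n is C(t, r-1) >= 1 at a = t, and 1 at a = 1, so the inequality at
    n' persists for all larger n. *)
Lemma threshold_le n n' : is_nprime k r n' -> k <= n' <= n ->
  'C(k.-1, r) + (n - k + 1) <= 'C(k - t, r) + (n - k + t) * 'C(t, r.-1).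
Proof.
move=> [[_ le] _] /andP[kn' n'n].
have tk : t <= k by rewrite /t; lia.
move: le; rewrite f_fstar_half f_one // fstar_nat ?tk ?kn' // => le.
have {}le : 'C(k.-1, r) + (n' - k + 1) <= 'C(k - t, r) + (n' - k + t) * 'C(t, r.-1) by lia.
have : 0 < 'C(t, r.-1) by rewrite bin_gt0 /t; lia.
move: le; have -> : n - k = n' - k + (n - n') by lia.
move: (n' - k) (n - n') 'C(t, r.-1) 'C(k.-1, r) 'C(k - t, r) => N d c x y.
clear; nia.
Qed.

Lemma threshold_gt n' : is_nprime k r n' -> k <= n' -> k < n'.
Proof.
move=> hn kn'; rewrite ltn_neqAle kn' andbT; apply/negP => /eqP Ek.
have := @threshold_le k n' hn; rewrite -Ek leqnn subnn add0n => /(_ isT).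
have := @half_core_le_full_core k t r hr; rewrite add0n => H; have := H _ _; rewrite /t; lia.
Qed.

Lemma core_bound_le n n' a : is_nprime k r n' -> k <= n' <= n -> 0 < a <= t ->
  core_bound (n - k) k r a <= 'C(k - t, r) + (n - k + t) * 'C(t, r.-1).
Proof.
move=> hn hnn at_.
have /(_ a at_) : forall a, 0 < a <= t ->
    core_bound (n - k) k r a <= maxn (core_bound (n - k) k r 1) (core_bound (n - k) k r t).
  apply: convex_le_endpoints => b b0 bt; apply: core_bound_convex.
  by apply: leq_trans bt _; rewrite /t; lia.
have mt : maxn 'C(t, r.-1) t = 'C(t, r.-1).
  by apply/maxn_idPl/bin_ge_self; rewrite /t; lia.
have m1 : maxn 'C(1, r.-1) 1 = 1.
  by case: r hr => [|[|[|m]]].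
have := threshold_le hn hnn; rewrite [core_bound _ _ _ t]/core_bound mt.
rewrite [core_bound _ _ _ 1]/core_bound m1.
rewrite muln1 subn1 => h1 /leq_trans-> //; by rewrite geq_max h1 leqnn.
Qed.

End Formula.

(** * The bound *)

Theorem theorem2p5 (n k r n' : nat) (hn' : is_nprime k r n')
  (hnn' : n' <= n) (hn'k : k <= n') (hkr : 4 * r <= k) (hr : 12 <= 4 * r)
  (T : finType) (E : {set {set T}}) (hT : #|T| = n)
  (hunif : uniform E r) (hconn : connected_hypergraph E)
  (hpath : ~ has_berge_path E k) :
  (#|E|%:Z <= f n k r (k - 1)./2)%R /\
  f n k r (k - 1)./2 = fstar n k r (k - 1)./2.
Proof.
have r2 : 2 < r by lia.
have ff := f_fstar_half hkr r2 n; split=> //; rewrite ff.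
set t := (k - 1)./2; have kn' := threshold_gt hkr r2 hn' hn'k.
have hkn : k <= n' <= n by rewrite hn'k.
have ht : [/\ t.*2 < k, k <= t.*2.+2 & r.*2 <= t.+1] by split; rewrite /t; lia.
have [t1 t2 t3] := ht.
rewrite fstar_nat; last by lia.
rewrite lez_nat.
have [X [D [Bl [mu [[XE BlD cardE mu_inj] [D2 muE mu_sub Xcl]]]]]] := matching_decomposition E.
have Xr e : e \in X -> #|e| = r by move/(subsetP XE)/hunif.
have r1 : 1 < r by lia.
have wT : weight X Bl [set: T] = #|E|.
  by rewrite cardE; congr (_ + _); apply: eq_card => e; rewrite inE subsetT andbT.
have no_path s : uniq s -> sorted (adj D) s -> size s != k.+1.
  case: s => // x s Us ps; apply/negP => /eqP[Es]; apply: hpath.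
  by rewrite -Es; apply: (adj_path_berge muE mu_sub mu_inj ps Us).
have sym := adj_sym D; have irr := adj_irr D2.
have [/existsP[A /andP[An0 /forall_inP dA]]|ncore] := boolP
   [exists A : {set T}, (A != set0) && [forall v in A, t < deg (adj D) A v]]; last first.
  (* every large set has a vertex of degree at most t: delete down to k - t vertices *)
  rewrite -wT; apply: leq_trans
    (weight_bound r1 BlD D2 Xr Xcl (S := set0) (m := k - t) (d := t) _ _ _ _ _) _.
  - by lia.
  - by rewrite cards0.
  - move=> A _ mA; have An0 : A != set0 by rewrite -card_gt0; lia.
    have /exists_inP[u uA du] : [exists u in A, deg (adj D) A u <= t].
      apply: contraNT ncore => /exists_inPn H; apply/existsP; exists A; rewrite An0.
      by apply/forall_inP => v vA; rewrite ltnNge H.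
    by exists u; rewrite inE.
  - exact: sub0set.
  - by rewrite cardsT hT; lia.
  rewrite cardsT hT; have -> : n - (k - t) = n - k + t by lia.
  by rewrite (maxn_idPl (bin_ge_self _)) //; lia.
have [K [c [[Uc cK cc /andP[tK Kk]] sepK]]] := kopylov_core sym irr t2 no_path An0 dA.
have szc : size c = #|K| by rewrite -(card_uniqP Uc); apply: eq_card.
have sz2 : 2 < size c by lia.
have berge U a := berge_path_from_cycle D2 muE mu_sub mu_inj (U := U) (a := a) hconn Uc cK cc sz2.
have [Ek|nk] := eqVneq #|K| k.
  (* K spans a cycle of length k and n > k: one step out of the cycle suffices *)
  case: hpath; rewrite -Ek -szc -[size c]addn0; apply: (berge (~: K)) => //.
    by rewrite -card_gt0 cardsCs setCK hT Ek; lia.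
  by rewrite disjoint_sym disjoints_subset.
have Klt : #|K| < k by rewrite ltn_neqAle nk.
have [/existsP[B /andP[KB /forall_inP dB]]|ndense] := boolP [exists B : {set T}, (K \proper B) &&
   [forall u in B, (u \notin K) ==> (k < #|K| + deg (adj D) B u)]].
  (* the deletions get stuck: B outside K is the set U that K must be linked to *)
  case: hpath; have <- : size c + (k - #|K|) = k by rewrite szc; lia.
  have sep x u : x \in K -> u \in B -> u \notin K -> ~~ adj D x u.
    apply: sepK; first exact: proper_sub.
    by move=> v vB; apply/implyP/dB.
  apply: (berge (B :\: K)).
  - by rewrite setD_eq0; case/andP: KB.
  - by rewrite disjoint_sym disjoints_subset setDE subsetIr.
  move=> u; rewrite inE => /andP[uK uB]; have := dB u uB; rewrite uK /=.
  suff -> : deg (adj D) (B :\: K) u = deg (adj D) B u by lia.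
  apply: eq_card => z; rewrite !inE; case: (boolP (z \in K)) => //= zK.
  by rewrite sym (negbTE (sep z u zK uB uK)) andbF.
have : core_bound (n - k) k r (k - #|K|) <= 'C(k - t, r) + (n - k + t) * 'C(t, r.-1).
  by apply: (core_bound_le hkr r2 hn' hkn); lia.
apply: leq_trans.
rewrite /core_bound subKn // -wT.
apply: leq_trans (weight_bound r1 BlD D2 Xr Xcl (S := K) (m := #|K|) (d := k - #|K|) _ _ _ _ _) _.
- by lia.
- by [].
- move=> A' KA mA.
  have : ~~ [forall u in A', (u \notin K) ==> (k < #|K| + deg (adj D) A' u)].
    apply: contra ndense => H; apply/existsP; exists A'; rewrite H properEcard KA mA //.
  case/forall_inPn => u uA; rewrite negb_imply -leqNgt => /andP[uK du].
  by exists u; split=> //; lia.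
- exact: subsetT.
- by rewrite cardsT max_card.
by rewrite cardsT hT leq_add2l leq_mul2r; apply/orP; right; lia.
Qed.
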